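(* Let $\mathcal{F}=\{f_1,\ldots,f_n\}$ be a system and assume that $s>s_0$. Then there exist a $\sigma$-algebra $\mathscr{B}_{\mathcal{F}}$ in $\mathbb{R}$ and a measure $\Lambda:\mathscr{B}_{\mathcal{F}}\to\mathbb{R}$ such that $$\Lambda(J)=\frac1s\left[\Lambda(f_{1}(J))+\cdots+\Lambda(f_{n}(J))\right]$$ for all $J\in\mathscr{B}_{\mathcal{F}}$.
   Context: A system is a finite family $\mathcal{F}=\{f_1,\ldots,f_n\}$ of continuous strictly monotone functions $f_i:I_i\to\mathbb{R}$, where $I_i=[c_i^{\ell},c_i^{r}]$ is a closed interval with more than one point. The points $c_i^\ell,c_i^r$ ($1\le i\le n$) are called turning points. For $J\subset\mathbb{R}$ not necessarily contained in $I_i$, $f_i(J)$ means $f_i(J\cap I_i)$. $S$ is the free semigroup (with identity $e$) generated by symbols $a_1,\ldots,a_n$, with word length $|\cdot|$. For $g=a_{i_1}a_{i_2}\cdots a_{i_m}\in S$ put $f_g=f_{i_m}\circ\cdots\circ f_{i_1}$ with its natural domain $\mathrm{Dom}(f_g)$ (possibly empty), and $f_e=\mathrm{Id}_{\mathbb{R}}$. For $m\ge1$ and a turning point $c$ define - $\ell(m)=\#\{g\in S:|g|=m,\ \mathrm{int}(\mathrm{Dom}(f_g))\ne\emptyset\}$; - $\ell'_c(m)=\#\{g\in S:|g|=m,\ \mathrm{int}(\mathrm{Dom}(f_g))\neq\emptyset,\ c\in\partial\,\mathrm{Dom}(f_g)\}$, where $\partial$ denotes the boundary. Put $s=\limsup_{m\to\infty}\ell(m)^{1/m}$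 and $s_0=\max_{c}\limsup_{m\to\infty}\ell'_{c}(m)^{1/m}$, the maximum being over all turning points $c$. *)

(* Defs.v *)
From HB Require Import structures.
From mathcomp Require Import all_boot all_order all_algebra.
From mathcomp Require Import all_classical all_reals all_analysis.
Set Implicit Arguments.
Unset Strict Implicit.
Unset Printing Implicit Defensive.
Import Order.TTheory GRing.Theory Num.Theory.
Import numFieldNormedType.Exports.
Local Open Scope classical_set_scope.
Local Open Scope ring_scope.

Definition strictly_monotone_on (R : realType) (I : interval R) (f : R -> R) :=
  {in I &, {homo f : x y / x < y}} \/ {in I &, {homo f : x y /~ x < y}}.

(* The i-th map is only meaningful on `[cl i, cr i]: [smap] is a total function
   whose values outside that interval are never used. *)
Record system (R : realType) (n : nat) := System {
  cl : 'I_n -> R;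
  cr : 'I_n -> R;
  smap : 'I_n -> R -> R;
  cl_lt_cr : forall i, cl i < cr i;
  smap_continuous : forall i, {within `[cl i, cr i], continuous (smap i)};
  smap_monotone : forall i, strictly_monotone_on `[cl i, cr i] (smap i)
}.

Section System.
Variables (R : realType) (n : nat) (F : system R n).

Definition sdom (i : 'I_n) : set R := `[cl F i, cr F i].

Definition simage (i : 'I_n) (J : set R) : set R := smap F i @` (J `&` sdom i).

Definition spartial (i : 'I_n) (x : R) : option R :=
  if x \in `[cl F i, cr F i] then Some (smap F i x) else None.

(* The word a_{i_1} ... a_{i_m} is the sequence [:: i_1; ...; i_m], and its map
   applies i_1 first; None means that the composition is undefined at x. *)
Definition word_map (g : seq 'I_n) (x : R) : option R :=
  foldl (fun y i => obind (spartial i) y) (Some x) g.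

Definition word_dom (g : seq 'I_n) : set R := [set x | isSome (word_map g x)].

Definition boundary (A : set R) : set R := closure A `\` interior A.

Definition lap_count (m : nat) : nat :=
  #|[set g : m.-tuple 'I_n | `[< interior (word_dom g) !=set0 >]]%SET|.

Definition bd_lap_count (c : R) (m : nat) : nat :=
  #|[set g : m.-tuple 'I_n |
      `[< interior (word_dom g) !=set0 /\ boundary (word_dom g) c >]]%SET|.

(* For the sequences u used below, u m <= n ^ m, so that the sequence of m-th
   roots is bounded and the real-valued limn_sup is the genuine limsup. The
   term m = 0, where m^-1 = 0, does not affect it. *)
Definition growth_rate (u : nat -> nat) : R :=
  limn_sup (fun m => (u m)%:R `^ (m%:R^-1)).

Definition lap_growth : R := growth_rate lap_count.

(* The base value 0 of the maximum is harmless: growth rates are nonnegative. *)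
Definition bd_lap_growth : R :=
  \big[Num.max/0]_(i < n)
    Num.max (growth_rate (bd_lap_count (cl F i)))
            (growth_rate (bd_lap_count (cr F i))).

End System.

(* Main.v *)
(** For a word [g], let [odom g] be the interior of the domain of its map. For
    each word [g] with [odom g] nonempty choose a point of [odom g] so that the
    point of [i :: g] is the [f_i]-preimage of the point of [g] whenever this is
    possible, and let [nu_m] be the counting measure on the points of the words
    of length [m]. The preimage is unavailable only if an endpoint of [I_i] lies
    on the boundary of the domain of [i :: g]; so [nu_(m+1) A] differs from
    [sum_i nu_m (f_i (A /\ int I_i))] by a quantity growing like [s0^m]. The
    sequence [l(m)] is submultiplicative, whence [l(m) >= s^m], and the
    normalised sums [sum_(m <= N) s^-m nu_m] have an ultrafilter limit [lam], a
    finitely additive probability on all sets of reals with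
    [lam A = s^-1 sum_i lam (f_i (A /\ int I_i))].

    Iterating this identity bounds [lam A] by [s^-m] times the number of words
    of length [m] whose domain meets [A]. If [p = f_i(c)] with [c] an endpoint of
    [I_i], the words touching [p] grow at a rate at most [s0 < s], so [p] has
    neighbourhoods of arbitrarily small [lam]-content. Let [P] be the
    Lebesgue-Stieltjes measure obtained from [lam]: on a segment [K] it is the
    infimum of [lam V] over the open sets [V] containing [K]. Since [lam] does not
    concentrate near the images of the turning points, the identity passes to
    [P] on segments, hence on all Borel sets. *)

Require Import Defs.
From HB Require Import structures.
From mathcomp Require Import all_boot all_order all_algebra.
From mathcomp Require Import all_classical all_reals all_analysis measurable_realfun.
From mathcomp Require Import ring lra.
Import Order.TTheory GRing.Theory Num.Theory.
Import numFieldNormedType.Exports.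
Set Implicit Arguments.
Unset Strict Implicit.
Unset Printing Implicit Defensive.
Local Open Scope classical_set_scope.
Local Open Scope ring_scope.

(** * Monotone bijections of the line *)

Section Homeomorphism.
Variable R : realType.
Implicit Types (h k f : R -> R) (c d : R).

Definition monotone_bijection h k :=
  [/\ cancel h k, cancel k h &
      {mono h : x y / x <= y} \/ {mono h : x y /~ x <= y}].

Lemma monotone_bijection_inv h k :
  monotone_bijection h k -> monotone_bijection k h.
Proof.
move=> [hK kK hm]; split => //; case: hm => hm; [left|right] => x y.
- by rewrite -hm !kK.
- by rewrite -hm !kK.
Qed.

Lemma monotone_bijection_opp h k : monotone_bijection h k ->
  monotone_bijection (fun x => - h x) (fun y => k (- y)).
Proof.
move=> [hK kK hm]; split.
- by move=> x; rewrite opprK hK.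
- by move=> x; rewrite kK opprK.
- by case: hm => hm; [right|left] => x y; rewrite lerN2 hm.
Qed.

(** Order and surjectivity suffice: an increasing [h] sends the open interval between [k (h x - e)]
    and [k (h x + e)] into the [e]-ball at [h x]. The decreasing case follows by negation. *)
Lemma monotone_bijection_continuous h k :
  monotone_bijection h k -> continuous h.
Proof.
wlog inc : h k / {mono h : x y / x <= y}.
  move=> H [hK kK [hm|hm]]; first by apply: (H h k) => //; split => //; left.
  have E : h = (fun x => - (- h x)) by apply/funext => x; rewrite opprK.
  rewrite E => x; apply: (@continuousN _ _ _ (fun x => - h x)).
  apply: (H _ (fun y => k (- y))).
    by move=> u v; rewrite lerN2 hm.
  by apply: monotone_bijection_opp; split => //; right.
move=> [hK kK _] x; apply/cvgrPdist_lt => e e0.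
have lt := leW_mono inc.
have l1 : k (h x - e) < x by rewrite -lt kK ltrBlDr ltrDl.
have l2 : x < k (h x + e) by rewrite -lt kK ltrDl.
have : x \in `]k (h x - e), k (h x + e)[ by rewrite in_itv/= l1.
move=> /near_in_itvoo; apply: filterS => y.
rewrite in_itv/= -(lt _ y) -(lt y) !kK => /andP[y1 y2].
by rewrite ltr_norml; lra.
Qed.

Lemma monotone_bijection_openX h k (A : set R) :
  monotone_bijection h k -> open A -> open (h @` A).
Proof.
move=> hk oA; have [hK kK _] := hk.
have -> : h @` A = k @^-1` A.
  apply/seteqP; split => [y [x Ax <-]|y Ay]; first by rewrite /preimage/= hK.
  by exists (k y).
apply: open_comp => // x _.
exact: (monotone_bijection_continuous (monotone_bijection_inv hk)).
Qed.

(** Outside [[c, d]] the map continues with slope 1, which keeps it strictly increasing; with the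
    intermediate value theorem on [[c, d]] this makes it onto. Total homeomorphisms let domains be
    written as preimages. *)
Lemma increasing_extension c d f : c < d -> {within `[c, d], continuous f} ->
  {in `[c, d] &, {homo f : x y / x < y}} ->
  exists h k, monotone_bijection h k /\ {in `[c, d], f =1 h}.
Proof.
move=> cd cf mf.
pose h x := if x < c then f c + (x - c) else if d < x then f d + (x - d) else f x.
have cI : c \in `[c, d] by rewrite in_itv/= lexx ltW.
have dI : d \in `[c, d] by rewrite in_itv/= lexx ltW.
have wf : {in `[c, d] &, {homo f : x y / x <= y}}.
  move=> x y xI yI; rewrite le_eqVlt => /predU1P[->//|xy].
  by apply/ltW/mf.
have hmono : {homo h : x y / x < y}.
  move=> x y xy; rewrite /h.
  have fcd := mf _ _ cI dI cd.
  case: (ltP x c) => xc; case: (ltP y c) => yc; try lra.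
  - case: (ltP d y) => yd; first lra.
    have : f c <= f y by apply: wf => //; rewrite in_itv/= yc yd.
    lra.
  - case: (ltP d x) => xd; case: (ltP d y) => yd; try lra.
    + have : f x <= f d by apply: wf => //; rewrite in_itv/= xc xd.
      lra.
    + by apply: mf => //; rewrite in_itv/= ?xc ?xd ?yc ?yd.
have surj y : exists x, h x = y.
  rewrite /h.
  case: (ltP y (f c)) => yc.
    exists (c + (y - f c)); case: ltP; lra.
  case: (ltP (f d) y) => yd.
    by exists (d + (y - f d)); do 2 (case: ltP; try lra).
  have [|x xI xy] := IVT (ltW cd) cf (v := y).
    have fcd := mf _ _ cI dI cd.
    by rewrite min_l ?max_r ?(ltW fcd)// yc.
  exists x; move: xI; rewrite in_itv/= => /andP[x1 x2].
  by rewrite !ltNge x1 x2.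
have [k kK] := choice surj.
exists h, k; split.
  have hm : {mono h : x y / x <= y} := le_mono hmono.
  split => //; last by left.
  by move=> x; apply: (inc_inj hm); rewrite kK.
move=> x; rewrite in_itv/= => /andP[x1 x2].
by rewrite /h !ltNge x1 x2.
Qed.

Lemma strictly_monotone_extension c d f : c < d ->
  {within `[c, d], continuous f} -> strictly_monotone_on `[c, d] f ->
  exists h k, monotone_bijection h k /\ {in `[c, d], f =1 h}.
Proof.
move=> cd cf [fm|fm]; first exact: increasing_extension.
have [||h [k [hk fh]]] := @increasing_extension c d (fun x => - f x) cd.
- by move=> x; apply: continuousN; apply: cf.
- by move=> x y xI yI xy; rewrite ltrN2; apply: fm.
exists (fun x => - h x), (fun y => k (- y)); split.
  exact: monotone_bijection_opp.
by move=> x xI; rewrite -fh// opprK.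
Qed.

End Homeomorphism.

(** * Growth rates *)

Section GrowthRate.
Variable R : realType.
Implicit Types (u : nat -> nat) (r : R).

Lemma root_power r m : 0 <= r -> (r `^ (m.+1%:R^-1)) ^+ m.+1 = r.
Proof. by move=> r0; rewrite -powR_mulrn ?powR_ge0// -powRrM mulVf// powRr1. Qed.

Variables (u : nat -> nat) (n : nat).
Hypothesis u_le : forall m, (u m <= n ^ m)%N.

Let root m : R := (u m)%:R `^ (m%:R^-1).

Let root_ge0 m : 0 <= root m. Proof. exact: powR_ge0. Qed.

Let root_le m : root m <= n.+1%:R.
Proof.
case: m => [|m]; first by rewrite /root invr0 powRr0 ler1n.
rewrite -(@ler_pXn2r _ m.+1)// ?nnegrE// root_power//.
by rewrite -natrX ler_nat (leq_trans (u_le _))// leq_exp2r.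
Qed.

Let root_bounded : bounded_fun root.
Proof.
exists n.+1%:R; split => // M nM m _ /=.
by rewrite ger0_norm// (le_trans (root_le m))// ltW.
Qed.

Let ub_root m : has_ubound (sdrop root m).
Proof. by exists n.+1%:R => _ [k _ <-]. Qed.

Let growthE : growth_rate R u = inf (range (sups root)).
Proof. by rewrite /growth_rate limn_supE. Qed.

Let sups_ge m k : (m <= k)%N -> root k <= sups root m.
Proof. by move=> mk; apply: ub_le_sup => //; exists k. Qed.

Let sups_lb : has_lbound (range (sups root)).
Proof. by exists 0 => _ [m _ <-]; apply: le_trans (sups_ge (leqnn m)). Qed.

Lemma growth_rate_ge0 : 0 <= growth_rate R u.
Proof.
rewrite growthE; apply: lb_le_inf; first by exists (sups root 0), 0%N.
by move=> _ [m _ <-]; apply: le_trans (sups_ge (leqnn m)).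
Qed.

Lemma growth_rate_lt r : growth_rate R u < r ->
  exists M, forall m, (M <= m)%N -> (u m)%:R <= r ^+ m.
Proof.
move=> ur; have r0 : 0 < r := le_lt_trans growth_rate_ge0 ur.
move: ur; rewrite growthE => /inf_lt[]; first by exists (sups root 0), 0%N.
(* [M.+1] excludes the index 0, where the root equals 1 whatever [u 0] is. *)
move=> _ [M _ <-] sr; exists M.+1 => -[//|m] Mm.
rewrite -[leLHS](@root_power _ m)//.
rewrite lerXn2r ?nnegrE ?root_ge0 ?(ltW r0)//.
by apply: le_trans (ltW sr); apply: sups_ge; apply: ltnW.
Qed.

Lemma growth_rate_gt r : 0 <= r < growth_rate R u ->
  forall M, exists2 m, (M <= m)%N & r ^+ m < (u m)%:R.
Proof.
move=> /andP[r0 ru] M; apply: contrapT => H.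
suff : growth_rate R u <= r by rewrite leNgt ru.
rewrite growthE; apply: (@le_trans _ _ (sups root M.+1)).
  by apply: ge_inf => //; exists M.+1.
apply: ge_sup; first by exists (root M.+1), M.+1 => /=.
move=> _ [[//|m] /= Mm <-].
rewrite -(@ler_pXn2r _ m.+1)// ?nnegrE// root_power//.
by rewrite leNgt; apply: contra_notN H => H; exists m.+1 => //; apply: ltnW.
Qed.

(* By Bernoulli's inequality (t / r)^m eventually exceeds C when t > r. *)
Lemma growth_rate_le_geometric (C r : R) (M : nat) : 0 < r ->
  (forall m, (M <= m)%N -> (u m)%:R <= C * r ^+ m) -> growth_rate R u <= r.
Proof.
move=> r0 uC; rewrite leNgt; apply/negP => ru.
pose g := growth_rate R u; pose t := (r + g) / 2.
have rt : r < t by rewrite /t midf_lt.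
have tg : t < g by rewrite /t midf_lt.
have t0 : 0 < t := lt_trans r0 rt.
pose q := t / r.
have q1 : 0 < q - 1 by rewrite subr_gt0 ltr_pdivlMr// mul1r.
have tI : 0 <= t < g by rewrite (ltW t0).
(* Past this index [m * (q - 1)] exceeds [C], and [m >= M] keeps the assumed bound in force. *)
have [m] := growth_rate_gt tI (maxn M (Num.truncn (C / (q - 1))).+1).
rewrite geq_max => /andP[Mm mC].
apply/negP; rewrite -leNgt (le_trans (uC _ Mm))//.
have -> : t = q * r by rewrite /q divfK// gt_eqF.
rewrite exprMn ler_pM2r ?exprn_gt0//.
have bern : 1 + m%:R * (q - 1) <= q ^+ m.
  elim: (m) => [|k IH]; first by rewrite mul0r addr0 expr0.
  rewrite exprS -natr1; apply: (@le_trans _ _ (q * (1 + k%:R * (q - 1)))).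
    have : 0 <= k%:R * (q - 1) ^+ 2 by rewrite mulr_ge0// sqr_ge0.
    by rewrite expr2; nra.
  by rewrite ler_pM2l//; lra.
apply: le_trans bern; rewrite ler_wpDl// -ler_pdivrMr//.
apply: le_trans (_ : (Num.truncn (C / (q - 1))).+1%:R <= _); last by rewrite ler_nat.
by apply/ltW/truncnS_gt.
Qed.

End GrowthRate.

(** * Geometric bounds and submultiplicative sequences *)

Section Asymptotics.
Variable R : realType.

Lemma sum_geometric_le (q : R) M : 0 <= q < 1 ->
  \sum_(m < M) q ^+ m <= (1 - q)^-1.
Proof.
move=> /andP[q0 q1]; rewrite -[leRHS]mul1r ler_pdivlMr ?subr_gt0//.
have -> : (\sum_(m < M) q ^+ m) * (1 - q) = 1 - q ^+ M.
  elim: M => [|M IH]; first by rewrite big_ord0 mul0r expr0 subrr.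
  by rewrite big_ord_recr/= mulrDl IH exprSr; ring.
by rewrite gerBl exprn_ge0.
Qed.

(* With q = p^2, the term m p^m is at most the geometric series of p. *)
Lemma mulr_expr_small (q e : R) : 0 <= q < 1 -> 0 < e ->
  exists m, m.+1%:R * q ^+ m <= e.
Proof.
move=> /andP[q0 q1] e0; pose p := Num.sqrt q.
have p0 : 0 <= p by exact: sqrtr_ge0.
have pq : p ^+ 2 = q by rewrite sqr_sqrtr.
have p1 : p < 1 by rewrite -sqrtr1 ltr_sqrt.
have p1' : 0 < 1 - p by rewrite subr_gt0.
have : p ^+ m @[m --> \oo] --> (0 : R) by apply: cvg_expr; rewrite ger0_norm.
move=> /cvgrPdist_lt/(_ (e * (1 - p)) (mulr_gt0 e0 p1'))[m _ /(_ m (leqnn m))].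
rewrite sub0r normrN ger0_norm ?exprn_ge0// => pm.
exists m; rewrite -pq -exprM mulnC exprM expr2 mulrA.
apply: (@le_trans _ _ ((1 - p)^-1 * p ^+ m)); last first.
  by rewrite mulrC ler_pdivrMr// ltW.
rewrite ler_wpM2r ?exprn_ge0//.
apply: le_trans (@sum_geometric_le p m.+1 _); last by rewrite p0.
rewrite -[m.+1 in leLHS]card_ord -sumr_const mulr_suml; apply: ler_sum => j _.
by rewrite mul1r ler_wiXn2l// ?ltW// -ltnS.
Qed.

Section Geometric.
Variables (u : nat -> nat) (C r s : R).
Hypothesis r_gt0 : 0 < r.
Hypothesis r_lt_s : r < s.
Hypothesis C_ge0 : 0 <= C.
Hypothesis u_le : forall m, (u m)%:R <= C * r ^+ m.

Let s_gt0 : 0 < s := lt_trans r_gt0 r_lt_s.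

Let q01 : 0 <= r / s < 1.
Proof. by rewrite divr_ge0 ?ltW//= ltr_pdivrMr// mul1r. Qed.

Lemma sum_div_geometric M : \sum_(m < M) (u m)%:R / s ^+ m <= C / (1 - r / s).
Proof.
apply: (@le_trans _ _ (C * \sum_(m < M) (r / s) ^+ m)); last first.
  by rewrite ler_wpM2l// sum_geometric_le.
rewrite mulr_sumr; apply: ler_sum => m _; rewrite expr_div_n mulrA.
by rewrite ler_pM2r ?invr_gt0 ?exprn_gt0.
Qed.

(** The convolution has [m] terms, each at most [C ^ 2 * r ^ m.+1]; the factor linear in [m] is
    beaten by [(r / s) ^ m]. The expression is the bound supplied by [word_count_cdom]. *)
Lemma convolution_small e : 0 < e -> exists m,
  (u m.+1 + \sum_(j < m) u j.+1 * u (m - j))%N%:R / s ^+ m <= e.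
Proof.
move=> e0; pose K := (C + C ^+ 2) * r.
have r0 : 0 <= r := ltW r_gt0.
have K0 : 0 <= K by rewrite mulr_ge0 ?addr_ge0 ?exprn_ge0.
have eK : 0 < e / (K + 1) by rewrite divr_gt0// ltr_wpDl.
have [m mP] := mulr_expr_small q01 eK.
exists m; rewrite ler_pdivrMr ?exprn_gt0//.
have T1 : (u m.+1 + \sum_(j < m) u j.+1 * u (m - j))%N%:R <=
    m.+1%:R * K * r ^+ m.
  rewrite natrD natr_sum.
  apply: (@le_trans _ _ (C * r ^+ m.+1 + \sum_(j < m) C ^+ 2 * r ^+ m.+1)).
    apply: lerD; first exact: u_le.
    apply: ler_sum => j _; rewrite natrM.
    apply: (@le_trans _ _ ((C * r ^+ j.+1) * (C * r ^+ (m - j)))).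
      by apply: ler_pM.
    by rewrite mulrACA -exprD addSn subnKC// ltnW.
  rewrite sumr_const card_ord -[_ *+ m]mulr_natl /K exprS -natr1.
  have rm : 0 <= r * r ^+ m by apply: mulr_ge0 => //; exact: exprn_ge0.
  have h1 := mulr_ge0 (ler0n _ m) (mulr_ge0 C_ge0 rm).
  have h2 := mulr_ge0 (exprn_ge0 2 C_ge0) rm.
  by lra.
apply: le_trans T1 _.
have -> : r ^+ m = (r / s) ^+ m * s ^+ m.
  by rewrite -exprMn divfK// gt_eqF.
rewrite mulrA ler_pM2r ?exprn_gt0// mulrAC.
apply: (@le_trans _ _ (e / (K + 1) * K)); first by rewrite ler_wpM2r.
by rewrite mulrAC ler_pdivrMr ?ltr_wpDl// ler_pM2l// lerDl.
Qed.

End Geometric.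

Lemma geometric_bound (u : nat -> nat) (C r : R) M : 0 < r -> 0 <= C ->
  (forall m, (M <= m)%N -> (u m)%:R <= C * r ^+ m) ->
  exists2 C', 0 <= C' & forall m, (u m)%:R <= C' * r ^+ m.
Proof.
(* Each of the finitely many early ratios is a summand of [B], so [C + B] covers them all. *)
move=> r0 C0 uM; pose B := \sum_(m < M) (u m)%:R / r ^+ m.
have B0 : 0 <= B by apply: sumr_ge0 => m _; rewrite divr_ge0 ?exprn_ge0 ?(ltW r0).
exists (C + B); first exact: addr_ge0.
move=> m; have rm := exprn_gt0 m r0.
have [/uM um|mM] := leqP M m.
  by apply: le_trans um _; rewrite ler_pM2r// lerDl.
rewrite -ler_pdivrMr//; apply: ler_wpDl => //.
rewrite /B (bigD1 (Ordinal mM))//= lerDl.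
by apply: sumr_ge0 => j _; rewrite divr_ge0 ?exprn_ge0 ?(ltW r0).
Qed.

Section Submultiplicative.
Variables (u : nat -> nat) (n : nat).
Hypothesis u_le : forall m, (u m <= n ^ m)%N.
Hypothesis u0 : u 0 = 1%N.
Hypothesis u_cat : forall m k, (u (m + k) <= u m * u k)%N.
Let s : R := growth_rate R u.
Hypothesis s_gt0 : 0 < s.

(* Fekete: a single term below s^k would propagate geometrically to all m. *)
Lemma submultiplicative_ge m : s ^+ m <= (u m)%:R.
Proof.
rewrite leNgt; apply/negP; case: m => [|k']; first by rewrite u0 expr0 ltxx.
set k := k'.+1 => uk.
(* The entry [s / 2] keeps [r] positive even if [u k] is 0. *)
pose r := Num.max ((u k)%:R `^ (k%:R^-1)) (s / 2).
have r0 : 0 < r by rewrite lt_max divr_gt0// orbT.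
have rs : r < s.
  rewrite gt_max; apply/andP; split; last by rewrite ltr_pdivrMr// ltr_pMr// ltr1n.
  by rewrite -(@ltr_pXn2r _ k)// ?nnegrE ?powR_ge0 ?(ltW s_gt0)// root_power.
have ur : (u k)%:R <= r ^+ k.
  rewrite -[leLHS](@root_power _ _ k')// lerXn2r ?nnegrE ?powR_ge0 ?(ltW r0)//.
  by rewrite le_max lexx.
suff [C _ uC] : exists2 C, 0 <= C & forall m, (u m)%:R <= C * r ^+ m.
  have : s <= r by apply: (growth_rate_le_geometric (C := C) (M := 0) u_le).
  by rewrite leNgt rs.
(* [C] covers the remainders modulo [k]; each further block of length [k] costs a factor [r ^ k]. *)
pose C := \sum_(t < k) (u t)%:R / r ^+ t.
have C0 : 0 <= C.
  by apply: sumr_ge0 => t _; rewrite divr_ge0 ?exprn_ge0 ?(ltW r0).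
exists C => // m; rewrite (divn_eq m k).
elim: (m %/ k)%N => [|a IH].
  rewrite mul0n add0n -ler_pdivrMr ?exprn_gt0//.
  have mk : (m %% k < k)%N by rewrite ltn_mod.
  rewrite /C (bigD1 (Ordinal mk))//= lerDl.
  by apply: sumr_ge0 => j _; rewrite divr_ge0 ?exprn_ge0 ?(ltW r0).
rewrite mulSn -addnA exprD mulrCA.
apply: (@le_trans _ _ ((u k)%:R * (u (a * k + m %% k)%N)%:R)).
  by rewrite -natrM ler_nat u_cat.
by apply: ler_pM.
Qed.

(** Otherwise the partial sums would gain a factor [1 + e] at every step from [M] on, forcing [u]
    above the powers of [s * (1 + e / 2)] at a late index, although its growth rate is only [s].
    This makes the last term of the averages negligible. *)
Lemma sum_dominates_next e : 0 < e -> forall M : nat, exists2 N, (M <= N)%N &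
  (u N.+1)%:R / s ^+ N.+1 <= e * \sum_(m < N.+1) (u m)%:R / s ^+ m.
Proof.
move=> e0 M; apply: contrapT => H.
pose A N := \sum_(m < N.+1) (u m)%:R / s ^+ m.
have H' N : (M <= N)%N -> e * A N < (u N.+1)%:R / s ^+ N.+1.
  by move=> MN; rewrite ltNge; apply: contra_notN H => H; exists N.
have A1 N : 1 <= A N.
  rewrite /A big_ord_recl u0 expr0 divr1 lerDl.
  by apply: sumr_ge0 => m _; rewrite divr_ge0 ?exprn_ge0 ?(ltW s_gt0).
have AM j : (1 + e) ^+ j <= A (M + j)%N.
  elim: j => [|j IH]; first by rewrite expr0.
  rewrite addnS /A big_ord_recr/= -/(A _) exprS.
  have := H' _ (leq_addr j M).
  have : (1 + e) * (1 + e) ^+ j <= (1 + e) * A (M + j)%N.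
    by rewrite ler_pM2l// addr_gt0.
  by lra.
pose t := s * (1 + e / 2).
have st : growth_rate R u < t by rewrite -/s /t ltr_pMr// ltrDl divr_gt0.
have [M' uM'] := growth_rate_lt u_le st.
pose q := (1 + e / 2) / (1 + e).
have e1 : 0 < 1 + e by rewrite addr_gt0.
have e2 : 0 < 1 + e / 2 by rewrite addr_gt0// divr_gt0.
have q0 : 0 < q by rewrite divr_gt0.
have q1 : q < 1 by rewrite ltr_pdivrMr// mul1r; lra.
have : q ^+ m @[m --> \oo] --> (0 : R) by apply: cvg_expr; rewrite ger0_norm ?ltW.
(* Below this threshold [q ^ j] is small enough for [e * (1 + e) ^ j] to exceed
   [(1 + e / 2) ^ (M + j).+1]. *)
have K0 : 0 < e / (1 + e / 2) ^+ M.+1 by rewrite divr_gt0// exprn_gt0.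
move=> /cvgrPdist_lt/(_ _ K0)[j0 _ jP].
have := jP (maxn j0 M') (leq_maxl _ _); rewrite /= sub0r normrN ger0_norm ?exprn_ge0 ?ltW//.
set j := maxn j0 M' => qj.
have := uM' (M + j).+1; have Mj : (M' <= (M + j).+1)%N.
  by rewrite ltnW// ltnS (leq_trans (leq_maxr j0 M'))// leq_addl.
move=> /(_ Mj); rewrite leNgt => /negP; apply.
have := H' _ (leq_addr j M); rewrite ltr_pdivlMr ?exprn_gt0//; apply: le_lt_trans.
rewrite /t exprMn mulrC ler_pM2r ?exprn_gt0//.
apply: (@le_trans _ _ (e * (1 + e) ^+ j)); last by rewrite ler_pM2l.
move: qj; rewrite /q expr_div_n ltr_pdivrMr ?exprn_gt0// mulrAC.
rewrite ltr_pdivlMr ?exprn_gt0// -exprD addnS addnC => /ltW.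
by [].
Qed.

End Submultiplicative.
End Asymptotics.

(** * Counting words *)

Section WordCount.
Variable n : nat.
Implicit Types (P Q : seq 'I_n -> Prop) (m k : nat).

Definition word_count P m : nat := #|[set t : m.-tuple 'I_n | `[< P t >]]%SET|.

(** The form with fixed length serves [near_word_count], where the implication is known only for
    words of length [m]. *)
Lemma le_word_count_tuple P Q m : (forall t : m.-tuple 'I_n, P t -> Q t) ->
  (word_count P m <= word_count Q m)%N.
Proof.
move=> PQ; apply/subset_leq_card/fintype.subsetP => t; rewrite !finset.inE.
by move=> /asboolP Pt; apply/asboolP; apply: PQ.
Qed.

Lemma le_word_count P Q m : (forall g, P g -> Q g) ->
  (word_count P m <= word_count Q m)%N.
Proof. by move=> PQ; apply: le_word_count_tuple => t; exact: PQ. Qed.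

Lemma eq_word_count P Q m : (forall g, P g <-> Q g) ->
  word_count P m = word_count Q m.
Proof.
by move=> PQ; apply/eqP; rewrite eqn_leq !le_word_count// => g; case: (PQ g).
Qed.

Lemma word_count0 P m : (forall g, ~ P g) -> word_count P m = 0%N.
Proof.
by move=> nP; apply/eqP; rewrite cards_eq0; apply/eqP/setP => t; rewrite !finset.inE; apply/asboolP.
Qed.

Lemma word_count_nil P : word_count P 0 = `[< P [::] >] :> nat.
Proof.
rewrite /word_count; case: asboolP => p0.
  have -> : [set t : 0.-tuple 'I_n | `[< P t >]]%SET = [set: 0.-tuple 'I_n]%SET.
    by apply/setP => t; rewrite !finset.inE tuple0; apply/asboolP.
  by rewrite cardsT card_tuple expn0.
by apply/eqP; rewrite cards_eq0; apply/eqP/setP => t; rewrite !finset.inE tuple0; apply/asboolP.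
Qed.

Lemma word_countS P m :
  word_count P m.+1 = (\sum_(i < n) word_count (fun g => P (i :: g)) m)%N.
Proof.
rewrite /word_count -sum1_card.
rewrite (reindex (fun p : 'I_n * m.-tuple 'I_n => [tuple of p.1 :: p.2])) /=; last first.
  exists (fun t : m.+1.-tuple 'I_n => (thead t, [tuple of behead t])).
    by move=> [i t] _ /=; rewrite theadE; congr pair; apply: val_inj.
  by move=> t _; rewrite [RHS]tuple_eta.
rewrite -(pair_big_dep xpredT (fun i (t : m.-tuple 'I_n) =>
  [tuple of i :: t] \in [set t : m.+1.-tuple 'I_n | `[< P t >]]%SET) (fun _ _ => 1%N)) /=.
apply: eq_bigr => i _; rewrite -sum1_card; apply: eq_bigl => t.
by rewrite !finset.inE.
Qed.

Lemma word_countU P Q m :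
  (word_count (fun g => P g \/ Q g) m <= word_count P m + word_count Q m)%N.
Proof.
have -> : word_count (fun g => P g \/ Q g) m =
    #|[set t : m.-tuple 'I_n | `[< P t >]] :|: [set t : m.-tuple 'I_n | `[< Q t >]]|%SET.
  apply: eq_card => t; rewrite !finset.inE.
  by apply/asboolP/orP => -[] ?; [left|right|left|right]; apply/asboolP.
by rewrite cardsU leq_subr.
Qed.

Lemma word_countU_disjoint P Q m : (forall g, ~ (P g /\ Q g)) ->
  word_count (fun g => P g \/ Q g) m = (word_count P m + word_count Q m)%N.
Proof.
move=> PQ0.
have -> : word_count (fun g => P g \/ Q g) m =
    #|[set t : m.-tuple 'I_n | `[< P t >]] :|: [set t : m.-tuple 'I_n | `[< Q t >]]|%SET.
  apply: eq_card => t; rewrite !finset.inE.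
  by apply/asboolP/orP => -[] ?; [left|right|left|right]; apply/asboolP.
rewrite cardsU (_ : (_ :&: _)%SET = finset.set0) ?cards0 ?subn0//.
apply/setP => t; rewrite !finset.inE; apply/negP => /andP[/asboolP Pt /asboolP Qt].
exact: (PQ0 t).
Qed.

Lemma word_count_le P m : (word_count P m <= n ^ m)%N.
Proof. by rewrite -[X in (X ^ _)%N]card_ord -card_tuple max_card. Qed.

(** A word of length [m + k] is determined by its two pieces; the induction peels off the first
    letter. Applied to [alive] it gives submultiplicativity. *)
Lemma word_count_cat P Q1 Q2 m k : (forall g h, P (g ++ h) -> Q1 g /\ Q2 h) ->
  (word_count P (m + k) <= word_count Q1 m * word_count Q2 k)%N.
Proof.
elim: m P Q1 => [|m IH] P Q1 PQ.
  rewrite add0n word_count_nil; case: asboolP => Q10.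
    by rewrite mul1n; apply: le_word_count => g /(PQ [::])[].
  by rewrite word_count0// => g /(PQ [::])[].
rewrite addSn !word_countS big_distrl/=; apply: leq_sum => i _.
by apply: IH => g h /(PQ (i :: g)).
Qed.

End WordCount.

(** * Finitely additive probabilities and their limits *)

Section Contents.
Variables (R : realType) (T : Type).
Implicit Types (A B : set T) (lam : set T -> R).

Definition content1 lam :=
  [/\ forall A, 0 <= lam A,
      forall A B, A `&` B = set0 -> lam (A `|` B) = lam A + lam B &
      lam setT = 1].

Lemma content1_set0 lam : content1 lam -> lam set0 = 0.
Proof.
move=> [_ lamU _]; have := lamU set0 set0 (setI0 _).
by rewrite setU0 => /eqP; rewrite -subr_eq subrr eq_sym => /eqP.
Qed.

Lemma le_content1 lam A B : content1 lam -> A `<=` B -> lam A <= lam B.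
Proof.
move=> [lam0 lamU _] AB; rewrite -(setDUK AB) lamU ?lerDl//.
exact: setDIK.
Qed.

Lemma content1_le1 lam A : content1 lam -> lam A <= 1.
Proof. by move=> lamc; have [_ _ <-] := lamc; apply: le_content1. Qed.

Lemma content1_leU lam A B : content1 lam -> lam (A `|` B) <= lam A + lam B.
Proof.
move=> lamc; have [_ lamU _] := lamc.
have -> : A `|` B = A `|` (B `\` A) by rewrite setUDr setDv setD0.
rewrite lamU ?setDIK// lerD2l; apply: le_content1 => //.
Qed.

(** Compactness provides a cluster point, and a cluster point of an ultrafilter is a limit. *)
Lemma ultrafilter_cvg (U : set_system nat) (u : nat -> R) (a b : R) :
  UltraFilter U -> (forall j, a <= u j <= b) ->
  exists l : R, u j @[j --> U] --> l.
Proof.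
move=> UU ab; have PU := @ultra_proper _ _ UU.
have uab : (u @ U) `[a, b]%classic.
  by apply: (@filterE _ U) => j; rewrite /preimage/= in_itv/= ab.
have [l [_ lU]] := @segment_compact R a b _ (fmap_proper_filter u PU) uab.
exists l => B lB.
have [//|UB] := in_ultra_setVsetC (u @^-1` B) UU.
by have [x [nBx Bx]] := lU (~` B) B UB lB.
Qed.

(** One ultrafilter serves all sets at once, whereas diagonal extraction of a subsequence would
    handle only countably many. That [U] contains [\oo] lets ordinary limits pass to [U]. *)
Lemma ultralimit_content1 (Lam : nat -> set T -> R) :
  (forall j, content1 (Lam j)) ->
  exists U lam, [/\ ProperFilter U, \oo `<=` U, content1 lam &
    forall A, Lam j A @[j --> U] --> lam A].
Proof.
move=> Lamc; have [U [UU ooU]] := ultraFilterLemma (F := \oo) _.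
have PU := @ultra_proper _ _ UU.
have cv A : exists l : R, Lam j A @[j --> U] --> l.
  apply: (@ultrafilter_cvg _ _ 0 1) => j; rewrite content1_le1// andbT.
  by have [] := Lamc j.
have [lam lamP] := choice cv.
exists U, lam; split => //; split.
- move=> A; apply: (cvgr_to_ge (lamP A)); apply: nearW => j; by have [] := Lamc j.
- move=> A B AB.
  have h : Lam j (A `|` B) @[j --> U] --> lam A + lam B.
    have -> : (fun j => Lam j (A `|` B)) = (fun j => Lam j A + Lam j B).
      by apply/funext => j; have [_ -> ] := Lamc j.
    by apply: cvgD; apply: lamP.
  exact: (cvg_unique (@Rhausdorff R) (lamP (A `|` B)) h).
- have h : Lam j setT @[j --> U] --> (1 : R).
    have -> : (fun j => Lam j setT) = cst 1.
      by apply/funext => j; have [_ _ ->] := Lamc j.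
    exact: cvg_cst.
  exact: (cvg_unique (@Rhausdorff R) (lamP setT) h).
Qed.

(** * Limits of averaged counting measures *)

Section Limit.
Variables (n : nat) (Phi : 'I_n -> set T -> set T) (nu : nat -> set T -> nat).
Variables (E : nat -> nat) (s C : R).
Hypothesis s_gt0 : 0 < s.
Hypothesis nuU : forall m A B, A `&` B = set0 ->
  nu m (A `|` B) = (nu m A + nu m B)%N.
Hypothesis nu0 : nu 0 setT = 1%N.
Hypothesis nuS_ge : forall m A, (\sum_(i < n) nu m (Phi i A) <= nu m.+1 A)%N.
Hypothesis nuS_le : forall m A,
  (nu m.+1 A <= \sum_(i < n) nu m (Phi i A) + E m.+1)%N.
Hypothesis E_sum : forall M, \sum_(m < M) (E m)%:R / s ^+ m <= C.

Let a m := (nu m setT)%:R / s ^+ m.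
Let S N A := \sum_(m < N.+1) (nu m A)%:R / s ^+ m.

Hypothesis a_ge1 : forall m, 1 <= a m.
Hypothesis a_sub : forall e : R, 0 < e -> forall M : nat,
  exists2 N, (M <= N)%N & a N.+1 <= e * \sum_(m < N.+1) a m.

Let nu_le m A : (nu m A <= nu m setT)%N.
Proof. by rewrite -(setUv A) nuU ?setICr// leq_addr. Qed.

Let sV m : 0 < (s ^+ m)^-1. Proof. by rewrite invr_gt0 exprn_gt0. Qed.

Let S_ge N : N.+1%:R <= S N setT.
Proof.
rewrite -[N.+1]card_ord -sumr_const /S; apply: ler_sum => m _; exact: a_ge1.
Qed.

(** Shift the index by one: the initial term is at most 1 and the errors add up to at most [C]. *)
Let S_le N A : S N A <= 1 + C + s^-1 * \sum_(i < n) S N (Phi i A).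
Proof.
rewrite {1}/S big_ord_recl -addrA; apply: lerD.
  by have := nu_le 0 A; rewrite expr0 divr1 nu0 -(ler_nat R).
apply: (@le_trans _ _ (\sum_(m < N) ((E m.+1)%:R / s ^+ m.+1 +
    s^-1 * \sum_(i < n) (nu m (Phi i A))%:R / s ^+ m))).
  apply: ler_sum => m _ /=; rewrite /bump/= add1n.
  rewrite -mulr_suml [s^-1 * _]mulrCA -invfM -exprS -mulrDl ler_pM2r//.
  by rewrite -natr_sum -natrD ler_nat addnC.
rewrite big_split/=; apply: lerD.
  apply: le_trans (E_sum N.+1); rewrite big_ord_recl lerDr.
  by rewrite mulr_ge0// ltW.
rewrite -mulr_sumr ler_pM2l ?invr_gt0// exchange_big/=; apply: ler_sum => i _.
by rewrite /S big_ord_recr/= lerDl mulr_ge0// ltW.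
Qed.

(** In this direction the shift overshoots by the term of index [N.+1], which is at most
    [a N.+1]. *)
Let S_geS N A : s^-1 * \sum_(i < n) S N (Phi i A) <= S N A + a N.+1.
Proof.
rewrite exchange_big mulr_sumr.
apply: (@le_trans _ _ (S N.+1 A)); last first.
  rewrite /S big_ord_recr lerD2l /a ler_pM2r// ler_nat; exact: nu_le.
rewrite /S [leRHS]big_ord_recl ler_wpDl//; first by rewrite mulr_ge0// ltW.
apply: ler_sum => m _; rewrite /= /bump/= add1n.
by rewrite -mulr_suml [s^-1 * _]mulrCA -invfM -exprS ler_pM2r// -natr_sum ler_nat.
Qed.

(** The defect of invariance is bounded by [1 + C] or by [a N.+1], according to its sign; both are
    negligible against the total mass [S N setT] along the indices chosen below. *)
Lemma limit_content : exists lam, content1 lam /\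
  forall A, lam A = s^-1 * \sum_(i < n) lam (Phi i A).
Proof.
have SN0 N : 0 < S N setT by apply: lt_le_trans (S_ge N); rewrite ltr0n.
have ex j : exists N, (j <= N)%N /\ a N.+1 <= j.+1%:R^-1 * S N setT.
  have j0 : 0 < j.+1%:R^-1 :> R by rewrite invr_gt0.
  by have [N] := a_sub j0 j; exists N.
have [N_ N_P] := choice ex.
pose Lam j A := S (N_ j) A / S (N_ j) setT.
have Lamc j : content1 (Lam j).
  split.
  - move=> A; rewrite divr_ge0// ?(ltW (SN0 _))//.
    by apply: sumr_ge0 => m _; rewrite mulr_ge0// ltW.
  - move=> A B AB; rewrite -mulrDl -big_split/=; congr (_ / _).
    by apply: eq_bigr => m _; rewrite nuU// natrD mulrDl.
  - by rewrite /Lam divff// gt_eqF.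
have [U [lam [PU ooU lamc lamP]]] := ultralimit_content1 Lamc.
exists lam; split => // A.
have cPhi : s^-1 * \sum_(i < n) Lam j (Phi i A) @[j --> U] -->
    s^-1 * \sum_(i < n) lam (Phi i A).
  apply: cvgMr.
  have -> : (fun j => \sum_(i < n) Lam j (Phi i A)) =
      \sum_(i < n) (fun j => Lam j (Phi i A)).
    by apply/funext => j; rewrite fct_sumE.
  elim/big_ind2: _ => [|u x v y ux vy|i _]; first exact: cvg_cst.
    exact: cvgD.
  exact: lamP.
have cD : (Lam j A - s^-1 * \sum_(i < n) Lam j (Phi i A)) @[j --> U] -->
    (lam A - s^-1 * \sum_(i < n) lam (Phi i A) : R).
  exact: cvgB.
apply/eqP; rewrite -subr_eq0; apply/eqP.
suff h : (Lam j A - s^-1 * \sum_(i < n) Lam j (Phi i A)) @[j --> U] --> (0 : R).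
  exact: (cvg_unique (@Rhausdorff R) cD h).
have C0 : 0 <= C by apply: le_trans (E_sum 0); rewrite big_ord0.
have harm : (1 + C) * j.+1%:R^-1 @[j --> U] --> (0 : R).
  have : (1 + C) * j.+1%:R^-1 @[j --> \oo] --> ((1 + C) * 0 : R).
    by apply: cvgMr; exact: cvg_harmonic.
  by rewrite mulr0 => h B /h /ooU.
apply/cvgrPdist_lt => e e0.
move/cvgrPdist_lt : harm => /(_ e e0); apply: filterS => j.
rewrite !sub0r !normrN; apply: le_lt_trans.
have [jN aN] := N_P j.
rewrite (ger0_norm (mulr_ge0 _ _)) ?addr_ge0//.
have -> : Lam j A - s^-1 * (\sum_(i < n) Lam j (Phi i A)) =
   (S (N_ j) A - s^-1 * \sum_(i < n) S (N_ j) (Phi i A)) / S (N_ j) setT.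
  by rewrite -mulr_suml mulrA -mulrBl.
rewrite normrM normfV (gtr0_norm (SN0 _)) ler_pdivrMr//.
have := S_le (N_ j) A; have := S_geS (N_ j) A; have := S_ge (N_ j).
set X := S (N_ j) A; set Y := s^-1 * _; set Z := S _ _ => Zge Yle Xle.
(* The total mass is at least [j.+1], since every [a m] is at least 1 and [j <= N_ j]. *)
have jZ : 1 <= j.+1%:R^-1 * Z.
  by rewrite mulrC ler_pdivlMr ?ltr0Sn// mul1r (le_trans _ Zge)// ler_nat.
rewrite -/Z in aN.
rewrite -mulrA; set W := _ * Z in aN jZ *.
have CW : 0 <= C * (W - 1) by rewrite mulr_ge0// subr_ge0.
have CW' : 0 <= C * W by rewrite mulr_ge0// (le_trans _ jZ).
by rewrite mulrDl mul1r ler_norml; apply/andP; split; lra.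
Qed.

End Limit.
End Contents.

(** * Regularization to a Borel measure *)

Section Regularization.
Variable R : realType.
Variable lam : set R -> R.
Hypothesis lamc : content1 lam.
Variables lo hi : R.
Hypothesis lam_supp : forall A, A `&` `[lo, hi] = set0 -> lam A = 0.

Let G x := lam `]-oo, x].
(** As [lam] is only finitely additive, [G] need not be right continuous; its right limit is the
    distribution function of a genuine measure. *)
Definition right_limit x := inf [set G y | y in `]x, +oo[%classic].

Local Notation Gr := right_limit.

Let G_nd : {homo G : x y / x <= y}.
Proof.
move=> x y xy; apply: le_content1 => //.
by apply: subset_itvl; rewrite bnd_simp.
Qed.

Let lam_oc a b : a <= b -> lam `]a, b] = G b - G a.
Proof.
move=> ab; have [_ lamU _] := lamc.
rewrite /G -(_ : `]-oo, a] `|` `]a, b] = `]-oo, b]%classic) ?lamU.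
- by rewrite addrAC subrr add0r.
- apply/seteqP; split => // x /=; rewrite !in_itv/= => -[xa /andP[/lt_le_trans/(_ xa)]].
  by rewrite ltxx.
- by rewrite -itv_bndbnd_setU ?bnd_simp.
Qed.

Let Gr_has x : has_inf [set G y | y in `]x, +oo[%classic].
Proof.
split; first by exists (G (x + 1)), (x + 1) => //=; rewrite in_itv/= andbT ltrDl.
by have [lam0 _ _] := lamc; exists 0 => _ [y _ <-]; exact: lam0.
Qed.

Let Gr_le x y : x < y -> Gr x <= G y.
Proof.
move=> xy; apply: ge_inf; first by have [] := Gr_has x.
by exists y => //=; rewrite in_itv/= andbT.
Qed.

Let le_Gr x y : x <= y -> G x <= Gr y.
Proof.
move=> xy; apply: lb_le_inf; first by have [] := Gr_has y.
move=> _ [z /= yz <-]; move: yz; rewrite in_itv/= andbT => yz.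
by apply/G_nd/(le_trans xy)/ltW.
Qed.

Let Gr_eps x e : 0 < e -> exists2 y, x < y & G y < Gr x + e.
Proof.
move=> e0; have [_ [y /= xy <-] yG] := inf_adherent e0 (Gr_has x).
by exists y => //; move: xy; rewrite in_itv/= andbT.
Qed.

Let Gr_nd : {homo Gr : x y / x <= y}.
Proof.
move=> x y; rewrite le_eqVlt => /predU1P[->//|xy].
exact: le_trans (Gr_le xy) (le_Gr (lexx y)).
Qed.

Let Gr_rc : right_continuous Gr.
Proof.
move=> x; apply/cvgrPdist_lt => e e0.
have [y xy Gy] := Gr_eps x e0.
near=> z.
have xz : x < z by near: z; exact: nbhs_right_gt.
have zy : z < y by near: z; exact: nbhs_right_lt.
rewrite distrC ger0_norm ?subr_ge0 ?Gr_nd ?(ltW xz)// ltrBlDl.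
exact: le_lt_trans (Gr_le zy) Gy.
Unshelve. all: by end_near. Qed.

Let G_lo x : x < lo -> G x = 0.
Proof.
move=> xlo; apply: lam_supp; apply/seteqP; split => // y /=.
by rewrite !in_itv/= => -[yx /andP[loy _]]; have := le_lt_trans (le_trans loy yx) xlo; rewrite ltxx.
Qed.

Let G_hi x : hi <= x -> G x = 1.
Proof.
move=> hix; have [_ lamU lam1] := lamc.
have disj : `]-oo, x] `&` `]x, +oo[ = set0 :> set R.
  apply/seteqP; split => // y /=; rewrite !in_itv/= andbT => -[yx xy].
  by move: (le_lt_trans yx xy); rewrite ltxx.
have : lam `]-oo, x] + lam `]x, +oo[ = 1.
  by rewrite -lamU// -lam1 -itv_bndbnd_setU ?bnd_simp// set_itvE.
rewrite (lam_supp (A := `]x, +oo[%classic)) ?addr0//.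
apply/seteqP; split => // y /=; rewrite !in_itv/= andbT => -[xy /andP[_ yhi]].
by have := lt_le_trans xy (le_trans yhi hix); rewrite ltxx.
Qed.

(** The bounded support of [lam] makes [Gr] constant near both infinities, so that the Stieltjes
    measure has total mass 1. *)
Let Gr_Ny : Gr @ -oo --> (0 : R).
Proof.
apply: cvg_near_cst; near=> x.
have [lam0 _ _] := lamc.
apply/eqP; rewrite eq_le; apply/andP; split; last first.
  apply: lb_le_inf; first by have [] := Gr_has x.
  by move=> _ [y _ <-]; exact: lam0.
have xlo : x < lo - 1 by near: x; apply: nbhs_ninfty_lt; exact: num_real.
apply: le_trans (Gr_le xlo) _.
by rewrite G_lo// ltrBlDr ltrDl.
Unshelve. all: by end_near. Qed.

Let Gr_y : Gr @ +oo --> (1 : R).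
Proof.
apply: cvg_near_cst; near=> x.
have hix : hi <= x by near: x; apply: nbhs_pinfty_ge; exact: num_real.
apply/eqP; rewrite eq_le; apply/andP; split.
  have x1 : x < x + 1 by rewrite ltrDl.
  by apply: le_trans (Gr_le x1) _; rewrite G_hi// (le_trans hix)// ltW.
by apply: le_trans (le_Gr (lexx x)); rewrite G_hi.
Unshelve. all: by end_near. Qed.

HB.instance Definition _ := isCumulative.Build R _ R Gr Gr_nd Gr_rc.
HB.instance Definition _ := isCumulativeBounded.Build R 0 1 Gr Gr_Ny Gr_y.


Let P : probability (measurableTypeR R) R := lebesgue_stieltjes_measure Gr.

Let P_oc a b : a <= b -> P `]a, b]%classic = (Gr b - Gr a)%:E.
Proof.
move=> ab.
rewrite /P/= /lebesgue_stieltjes_measure /measure_extension measurable_mu_extE/=.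
  by rewrite wlength_itv_bnd.
exact: is_ocitv.
Qed.

(** The Stieltjes measure is explicit on half-open intervals; segments are reached from them by
    continuity from above. *)
Let P_cc a b : a <= b ->
  P `]a - n.+1%:R^-1, b]%classic @[n --> \oo] --> P `[a, b]%classic.
Proof.
move=> ab.
have -> : `[a, b]%classic = \bigcap_n `]a - n.+1%:R^-1, b]%classic.
  apply/seteqP; split => x.
    rewrite /= in_itv/= => /andP[ax xb] n _ /=.
    by rewrite in_itv/= xb andbT (lt_le_trans _ ax)// ltrBlDr ltrDl.
  move=> H; have := H 0%N I; rewrite /= !in_itv/= => /andP[_ xb].
  rewrite xb andbT; apply/ler_addgt0Pr => e e0.
  have [n _ /(_ n (leqnn n))] := near_infty_natSinv_lt (PosNum e0).
  move=> ne; have := H n I; rewrite /= in_itv/= => /andP[ax _].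
  by have ne' : n.+1%:R^-1 < e := ne; move: ne' ax; set w := _^-1 => *; lra.
apply: nonincreasing_cvg_mu.
- by rewrite (le_lt_trans (probability_le1 _ _)) ?ltry//; exact: measurable_itv.
- by move=> n; exact: measurable_itv.
- by apply: bigcapT_measurable => n; exact: measurable_itv.
- move=> m n mn; apply/subsetPset; apply: subset_itvr; rewrite bnd_simp.
  by rewrite lerB// lef_pV2 ?posrE// ler_nat.
Qed.

(** Rests on [Gr x <= G y <= Gr y] for [x < y]: widening a segment slightly absorbs the difference
    between [G] and its right limit. *)
Lemma content_regularization :
  exists P : probability (measurableTypeR R) R, forall a b : R,
    (forall V : set R, open V -> `[a, b] `<=` V -> (P `[a, b]%classic <= (lam V)%:E)%E) /\
    (forall e, 0 < e -> exists V : set R, [/\ open V, `[a, b] `<=` V &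
       ((lam V)%:E <= P `[a, b]%classic + e%:E)%E]).
Proof.
have [lam0 _ _] := lamc.
exists P => a b.
(* Empty segments must be covered, as [image_segment] can produce one. *)
have [ab|ba] := leP a b; last first.
  have -> : `[a, b]%classic = set0 :> set R by rewrite set_itv_ge// bnd_simp -ltNge.
  split=> [V _ _|e e0]; first by rewrite measure0 lee_fin.
  exists set0; split => //.
  by rewrite (content1_set0 lamc) measure0 add0e lee_fin ltW.
split=> [V oV abV|e e0].
  have aV : nbhs a V by apply: open_nbhs_nbhs; split => //; apply: abV => /=; rewrite in_itv/= lexx.
  have bV : nbhs b V by apply: open_nbhs_nbhs; split => //; apply: abV => /=; rewrite in_itv/= lexx ab.
  move: aV bV => /nbhs_ballP[d /= d0 dV] /nbhs_ballP[d' /= d'0 d'V].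
  pose a0 := a - d / 2; pose b0 := b + d' / 2.
  have a0a : a0 < a by rewrite ltrBlDr ltrDl divr_gt0.
  have bb0 : b < b0 by rewrite ltrDl divr_gt0.
  have abV' : `]a0, b0] `<=` V.
    move=> x /=; rewrite in_itv/= /a0 /b0 => /andP[ax xb].
    have [xa|] := ltP x a; first by apply: dV; rewrite /ball/= ltr_norml; lra.
    move=> ax'; have [bx|xb'] := ltP b x.
      by apply: d'V; rewrite /ball/= ltr_norml; lra.
    by apply: abV; rewrite /= in_itv/= ax'.
  apply: (@le_trans _ _ (P `]a0, b]%classic)).
    apply: le_measure; rewrite ?inE; [exact: measurable_itv|exact: measurable_itv|].
    by apply: subset_itvr; rewrite bnd_simp.
  rewrite P_oc ?(le_trans (ltW a0a))// lee_fin.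
  apply: le_trans (le_content1 lamc abV').
  rewrite lam_oc ?(le_trans (ltW a0a)) ?(le_trans ab) ?(ltW bb0)//.
  by rewrite lerB ?Gr_le// le_Gr.
have e2 : 0 < e / 2 by rewrite divr_gt0.
have [b1 bb1 Gb1] := Gr_eps b e2.
have Pfin : P `[a, b]%classic \is a fin_num by apply: fin_num_measure; exact: measurable_itv.
have Pcv := P_cc ab.
rewrite -(fineK Pfin) in Pcv.
have fcv : fine (P `]a - n.+1%:R^-1, b]%classic) @[n --> \oo] -->
    fine (P `[a, b]%classic) by apply: (fine_cvg Pcv).
have [N _ /(_ N (leqnn N)) PN] := @cvgr_lt _ _ _ _ _ _ fcv _ (ltr_pwDr e2 (lexx _)).
have N0 : 0 < N.+1%:R^-1 :> R by rewrite invr_gt0.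
(* Two points to the left of [a]: the measure is controlled from [a0], and [Gr a0 <= G a1] transfers
   this to the content of []a1, b1[]. *)
set w : R := N.+1%:R^-1 in N0 PN; pose a0 := a - w; pose a1 := a - w / 2.
have a0a1 : a0 < a1 by rewrite /a0 /a1; lra.
have a1a : a1 < a by rewrite /a1; lra.
have a0b : a0 <= b by apply: le_trans ab; apply: ltW; apply: lt_trans a1a.
move: PN; rewrite -/a0 P_oc//= => PN.
exists `]a1, b1[%classic; split; first exact: interval_open.
  move=> x /=; rewrite !in_itv/= => /andP[ax xb].
  by rewrite (lt_le_trans a1a)// (le_lt_trans xb).
rewrite -(fineK Pfin) -EFinD lee_fin.
have : lam `]a1, b1[ <= lam `]a1, b1].
  by apply: le_content1 => //; apply: subset_itvl; rewrite bnd_simp.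
have := Gr_le a0a1.
rewrite lam_oc; first lra.
by apply/ltW/(lt_trans a1a)/(le_lt_trans ab).
Qed.

End Regularization.

(** * Domains of words *)

Section WordDomains.
Variables (R : realType) (n : nat) (c d : 'I_n -> R) (h k : 'I_n -> R -> R).
Hypothesis cd : forall i, c i < d i.
Hypothesis hk : forall i, monotone_bijection (h i) (k i).
Implicit Types (g : seq 'I_n) (x p : R) (m : nat).

(** The maps [h i] are total, so a domain is an iterated preimage. Closed intervals give the domain
    of the word ([word_dom_cdom]), open ones the interior of that domain ([interior_cdom]). *)
Fixpoint odom g : set R :=
  if g is i :: g' then `]c i, d i[ `&` h i @^-1` odom g' else setT.

Fixpoint cdom g : set R :=
  if g is i :: g' then `[c i, d i] `&` h i @^-1` cdom g' else setT.

Definition alive g := odom g !=set0.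

(** As [cdom g] is closed with interior [odom g], the last two clauses say that [x] lies on the
    boundary of the domain. *)
Definition bd_word x g := [/\ alive g, cdom g x & ~ odom g x].

Definition bd_total m : nat :=
  \sum_(i < n) (word_count (bd_word (c i)) m + word_count (bd_word (d i)) m).

Let hC i : continuous (h i).
Proof. exact: monotone_bijection_continuous. Qed.

Let kC i : continuous (k i).
Proof. exact: monotone_bijection_continuous (monotone_bijection_inv (hk i)). Qed.

Let hK i : cancel (h i) (k i). Proof. by have [] := hk i. Qed.
Let kK i : cancel (k i) (h i). Proof. by have [] := hk i. Qed.

Lemma open_odom g : open (odom g).
Proof.
elim: g => [|i g IH] /=; first exact: openT.
by apply: openI; [exact: interval_open|apply: open_comp => // x _; exact: hC].
Qed.

Lemma closed_cdom g : closed (cdom g).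
Proof.
elim: g => [|i g IH] /=; first exact: closedT.
by apply: closedI; [exact: interval_closed|apply: closed_comp => // x _; exact: hC].
Qed.

Lemma odom_sub g : odom g `<=` cdom g.
Proof.
elim: g => [//|i g IH] x [/= xI /IH]; split => //.
exact: subset_itv_oo_cc xI.
Qed.

(** Interiors commute with finite intersections and, each [h i] being a homeomorphism, with
    preimages. *)
Lemma interior_cdom g : interior (cdom g) = odom g.
Proof.
elim: g => [|i g IH] /=; first exact: interiorT.
rewrite interiorI; congr (_ `&` _); first exact: interior_itv_bnd.
rewrite -IH; apply/seteqP; split => x.
  move=> xD; have : nbhs (h i x) (k i @^-1` (h i @^-1` cdom g)).
    by apply: kC; rewrite hK.
  by apply: filterS => y; rewrite /preimage/= kK.
exact: hC.
Qed.

Lemma odom_convex g x y z : odom g x -> odom g z -> x <= y <= z -> odom g y.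
Proof.
elim: g x y z => [//|i g IH] x y z /= [xI gx] [zI gz] /andP[xy yz].
split.
  move: xI zI; rewrite /= !in_itv/= => /andP[x1 _] /andP[_ z1].
  by rewrite (lt_le_trans x1 xy) (le_lt_trans yz z1).
have [_ _ [hm|hm]] := hk i.
- by apply: (IH _ _ _ gx gz); rewrite !hm xy.
- by apply: (IH _ _ _ gz gx); rewrite !hm xy yz.
Qed.

Lemma alive_cons i g : alive (i :: g) -> alive g.
Proof. by move=> [x [_ gx]]; exists (h i x). Qed.

Lemma alive_cat g1 g2 : alive (g1 ++ g2) -> alive g1 /\ alive g2.
Proof.
suff odomP x : odom (g1 ++ g2) x -> odom g1 x /\ alive g2.
  by move=> [x /odomP[g1x ag2]]; split => //; exists x.
elim: g1 x => [|i g1 IH] x /=; first by move=> g2x; split => //; exists x.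
by move=> [xI /IH[]].
Qed.

(** By continuity [h i] also sends points slightly inside [[c i, d i]] into the open set [odom g],
    so [i :: g] is alive, while [e] itself is only an endpoint. *)
Lemma odom_bd_word i g e : e = c i \/ e = d i -> odom g (h i e) ->
  bd_word e (i :: g).
Proof.
move=> eE ge.
have eI : e \in `[c i, d i].
  by case: eE => ->; rewrite in_itv/= lexx ?andbT ltW.
split; last first.
- by move=> [/=]; rewrite in_itv/=; case: eE => ->; rewrite ltxx ?andbF.
- by split => //; apply: odom_sub.
have : nbhs e (h i @^-1` odom g).
  by apply: hC; apply: open_nbhs_nbhs; split => //; exact: open_odom.
move=> /nbhs_ballP[r /= r0 rV].
(* Moving inwards by [t] from [e] neither leaves the ball nor passes the midpoint of the
   interval. *)
pose t := Num.min (r / 2) ((d i - c i) / 2).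
have t0 : 0 < t by rewrite lt_min !divr_gt0// subr_gt0.
have tr : t <= r / 2 by rewrite ge_min lexx.
have tcd : t <= (d i - c i) / 2 by rewrite ge_min lexx orbT.
have cdi := cd i.
case: eE => E; subst e.
- exists (c i + t); split; first by rewrite /= in_itv/=; apply/andP; split; lra.
  by apply: rV; rewrite /ball/= ltr_norml; apply/andP; split; lra.
- exists (d i - t); split; first by rewrite /= in_itv/=; apply/andP; split; lra.
  by apply: rV; rewrite /ball/= ltr_norml; apply/andP; split; lra.
Qed.

Lemma bd_total_ge e m : (exists i, e = c i \/ e = d i) ->
  (word_count (bd_word e) m <= bd_total m)%N.
Proof.
move=> [i ie]; rewrite /bd_total (bigD1 i)//=.
apply: leq_trans (leq_addr _ _).
by case: ie => ->; rewrite ?leq_addr ?leq_addl.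
Qed.

Lemma word_count_odom i e m : e = c i \/ e = d i ->
  (word_count (fun g => odom g (h i e)) m <= bd_total m.+1)%N.
Proof.
move=> ie; apply: leq_trans (bd_total_ge m.+1 (ex_intro _ i ie)).
rewrite word_countS (bigD1 i)//=; apply: leq_trans (leq_addr _ _).
by apply: le_word_count => g; exact: odom_bd_word.
Qed.

(* Follow the orbit of p along a word having p on its boundary until it first
   meets a turning point. *)
Lemma word_count_bd p m : (word_count (bd_word p) m <=
  \sum_(j < m) word_count (fun g => odom g p) j * bd_total (m - j))%N.
Proof.
elim: m p => [|m IH] p.
  by rewrite word_count_nil big_ord0; case: asboolP => // -[_ _ []].
rewrite big_ord_recl subn0 word_count_nil.
have -> : `[< odom [::] p >] = true by apply/asboolP.
rewrite mul1n.
(* If [p] is itself a turning point, the term [j = 0] alone bounds the count. *)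
have [tp|ntp] := pselect (exists i, p = c i \/ p = d i).
  by apply: leq_trans (bd_total_ge _ tp) _; rewrite leq_addr.
(* Otherwise a first letter counts only if [p] is interior to its interval, and the induction
   hypothesis applies at [h i p]. *)
apply: leq_trans (leq_addl _ _).
rewrite word_countS.
apply: (@leq_trans (\sum_(i < n | p \in `]c i, d i[)
   \sum_(j < m) word_count (fun g => odom g (h i p)) j * bd_total (m - j))).
  rewrite [leqRHS]big_mkcond/=; apply: leq_sum => i _.
  case: ifPn => pI.
    apply: leq_trans (IH (h i p)); apply: le_word_count => g [ag [pcd gp] ngp].
    split => //; first exact: alive_cons ag.
    by move=> gp'; apply: ngp.
  rewrite word_count0// => g [_ [/= pcd _] _]; apply: ntp; exists i.
  move: pI pcd; rewrite !in_itv/= => pI /andP[cp pd].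
  have [->|cp'] := eqVneq p (c i); first by left.
  have [->|pd'] := eqVneq p (d i); first by right.
  by move: pI; rewrite lt_neqAle eq_sym cp' cp lt_neqAle pd' pd.
rewrite exchange_big/=; apply: leq_sum => j _.
rewrite /bump/= add1n subSS -big_distrl/= leq_mul2r word_countS; apply/orP; right.
rewrite [leqLHS]big_mkcond/=; apply: leq_sum => i _; case: ifPn => // pI.
by apply: le_word_count => g gp.
Qed.

(** The point [h i e] is interior to the domain or on its boundary. In the second case
    [word_count_bd] applies, and prefixing [i] turns the orbit segments it counts into boundary
    words of [e]. *)
Lemma word_count_cdom i e m : e = c i \/ e = d i ->
  (word_count (fun g => alive g /\ cdom g (h i e)) m <=
   bd_total m.+1 + \sum_(j < m) bd_total j.+1 * bd_total (m - j))%N.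
Proof.
move=> ie.
apply: (@leq_trans (word_count (fun g => odom g (h i e) \/ bd_word (h i e) g) m)).
  apply: le_word_count => g [ag gp].
  by have [|] := pselect (odom g (h i e)); [left|right].
apply: leq_trans (word_countU _ _ _) _; apply: leq_add.
  exact: word_count_odom.
apply: leq_trans (word_count_bd _ _) _; apply: leq_sum => j _.
by rewrite leq_mul2r word_count_odom// orbT.
Qed.

(** Compatibility with the inverse branches makes the counts nearly invariant. An arbitrary point is
    taken only when the preimage leaves the open interval; the default of [xget] is reached only if
    [odom (i :: g')] is empty. *)
Fixpoint word_point g : R :=
  if g is i :: g' then
    if k i (word_point g') \in `]c i, d i[ then k i (word_point g')
    else xget 0 (odom (i :: g'))
  else 0.

Lemma word_pointP g : alive g -> odom g (word_point g).
Proof.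
elim: g => [//|i g IH] ag /=; case: ifPn => [kI|_].
  by split => //; rewrite /preimage/= kK; apply/IH/(alive_cons ag).
by have [x gx] := ag; exact: (xgetPex 0 (ex_intro _ x gx)).
Qed.

Definition point_count m (A : set R) :=
  word_count (fun g => alive g /\ A (word_point g)) m.

Definition open_image i (A : set R) : set R := h i @` (A `&` `]c i, d i[).

Lemma point_countU m A B : A `&` B = set0 ->
  point_count m (A `|` B) = (point_count m A + point_count m B)%N.
Proof.
move=> AB0; rewrite /point_count -word_countU_disjoint.
  by apply: eq_word_count => g; split => [[ag [?|?]]|[[]|[]]]; [left|right|split=> //; left|split=> //; right].
by move=> g [[_ Ag] [_ Bg]]; have : set0 (word_point g) by rewrite -AB0.
Qed.

Lemma point_countT m : point_count m setT = word_count alive m.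
Proof. by apply: eq_word_count => g; split=> [[]|]. Qed.

(** The preimage of the point of [g] lies in the open interval, so the first branch of [word_point]
    is taken. *)
Lemma open_image_alive i g A : alive g -> open_image i A (word_point g) ->
  alive (i :: g) /\ A (word_point (i :: g)).
Proof.
move=> ag [x [Ax xI] xg] /=; rewrite -xg hK xI; split => //.
by exists x; split => //; rewrite /preimage/= xg; exact: word_pointP.
Qed.

(** Suppose the preimage of the point of [g] falls outside []c i, d i[]. The pullback of [odom g]
    under [h i] is convex and contains both this preimage and a point of the interval, hence the
    endpoint between them, and [odom_bd_word] applies. *)
Lemma alive_open_image i g A : alive (i :: g) -> A (word_point (i :: g)) ->
  (alive g /\ open_image i A (word_point g)) \/
  (bd_word (c i) (i :: g) \/ bd_word (d i) (i :: g)).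
Proof.
move=> ag /=; case: ifPn => [kI Ak|kI _].
  left; split; first exact: alive_cons ag.
  by exists (k i (word_point g)); rewrite ?kK.
right; have ag' := alive_cons ag.
have := word_pointP ag'; rewrite -{1}(kK i (word_point g)) => gp; have [z [/= zI gz]] := ag.
move: zI; rewrite in_itv/= => /andP[cz zd].
have mid y : k i (word_point g) <= y <= z \/ z <= y <= k i (word_point g) ->
    odom g (h i y).
  have [_ _ [hm|hm]] := hk i; case=> /andP[y1 y2].
  - by apply: (odom_convex gp gz); rewrite !hm y1 y2.
  - by apply: (odom_convex gz gp); rewrite !hm y1 y2.
  - by apply: (odom_convex gz gp); rewrite !hm y1 y2.
  - by apply: (odom_convex gp gz); rewrite !hm y1 y2.
move: kI; rewrite in_itv/= negb_and -!leNgt => /orP[kc|kd].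
- by left; apply: odom_bd_word; [left|apply: mid; left; rewrite kc ltW].
- by right; apply: odom_bd_word; [right|apply: mid; right; rewrite kd ltW].
Qed.

Lemma point_countS_ge m A :
  (\sum_(i < n) point_count m (open_image i A) <= point_count m.+1 A)%N.
Proof.
rewrite /point_count word_countS; apply: leq_sum => i _.
by apply: le_word_count => g [ag]; exact: open_image_alive.
Qed.

Lemma point_countS_le m A : (point_count m.+1 A <=
  \sum_(i < n) point_count m (open_image i A) + bd_total m.+1)%N.
Proof.
rewrite /point_count word_countS.
apply: (@leq_trans (\sum_(i < n) (point_count m (open_image i A) +
  (word_count (fun g => bd_word (c i) (i :: g)) m +
   word_count (fun g => bd_word (d i) (i :: g)) m)))).
  apply: leq_sum => i _; apply: leq_trans (leq_add (leqnn _) (word_countU _ _ _)).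
  apply: leq_trans (word_countU _ _ _).
  by apply: le_word_count => g [ag]; exact: alive_open_image.
rewrite big_split/= leq_add2l; apply: leq_sum => i _.
(* The errors involve only boundary words beginning with [i]; counting all first letters yields
   [bd_total]. *)
by rewrite !word_countS; apply: leq_add; rewrite (bigD1 i)//= leq_addr.
Qed.

(** Iterate the identity [m] times: each word of length [m] contributes at most [1 / s ^ m], and
    only if [A] meets its open domain. *)
Lemma content_le_word_count (s : R) (lam : set R -> R) : 0 < s -> content1 lam ->
  (forall A, lam A = s^-1 * \sum_(i < n) lam (open_image i A)) ->
  forall m A, lam A <= (word_count (fun g => A `&` odom g !=set0) m)%:R / s ^+ m.
Proof.
move=> s0 lamc lamE; elim=> [|m IH] A.
  rewrite word_count_nil expr0 divr1; case: asboolP => [_|A0].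
    exact: content1_le1.
  have -> : A = set0.
    by apply/seteqP; split => // x Ax; apply: A0; exists x.
  by rewrite content1_set0.
rewrite lamE exprS invfM mulrCA ler_pM2l ?invr_gt0//.
rewrite word_countS natr_sum mulr_suml; apply: ler_sum => i _.
apply: le_trans (IH _) _; rewrite ler_pM2r ?invr_gt0 ?exprn_gt0// ler_nat.
apply: le_word_count => g [_ [[x [Ax xI] <-] gx]].
by exists x.
Qed.

(* The finitely many closed domains avoiding p miss a common neighbourhood of p. *)
Lemma near_word_count p m : exists V : set R, [/\ open V, V p &
  (word_count (fun g => V `&` odom g !=set0) m <=
   word_count (fun g => alive g /\ cdom g p) m)%N].
Proof.
(* For a word whose closed domain contains [p] this is the whole line, otherwise the complement of
   that domain. *)
pose W (t : m.-tuple 'I_n) : set R := [set x | cdom t x -> cdom t p].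
have WV (t : m.-tuple 'I_n) : nbhs p (W t).
  have [tp|ntp] := pselect (cdom t p); first by apply: filterE => x ?.
  have : nbhs p (~` cdom t).
    apply: open_nbhs_nbhs; split => //; exact/closed_openC/closed_cdom.
  by apply: filterS => x nx /nx.
exists (interior [set x | forall t, W t x]); split.
- exact: open_interior.
- exact: (filter_forall (nbhs_filter p) WV).
apply: le_word_count_tuple => t [x [/interior_subset Vx tx]].
by split; [exists x|exact: (Vx t (odom_sub tx))].
Qed.

End WordDomains.

(** * The invariant measure *)

Section FinitePushforward.
Context d1 d2 (T1 : measurableType d1) (T2 : measurableType d2) (R : realType).
Variables (f : T1 -> T2) (mf : measurable_fun setT f).
Variable mu : {finite_measure set T1 -> \bar R}.

Let map := pushforward mu f.

Let map0 : map set0 = 0%E. Proof. exact: measure0. Qed.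

Let map_ge0 A : (0 <= map A)%E. Proof. exact: measure_ge0. Qed.

Let map_sigma_additive : semi_sigma_additive map.
Proof. exact: measure_semi_sigma_additive. Qed.

HB.instance Definition _ := isMeasure.Build _ _ _ map
  map0 map_ge0 map_sigma_additive.

Let map_fin : fin_num_fun map.
Proof.
move=> A mA; apply: fin_num_measure.
by rewrite -[X in measurable X]setTI; exact: mf.
Qed.

HB.instance Definition _ := Measure_isFinite.Build _ _ _ map map_fin.

(** Serves twice: for the inverse branches [k i], and for the identity between two presentations of
    the Borel sigma-algebra. *)
Lemma finite_pushforward : exists nu : {finite_measure set T2 -> \bar R},
  forall A, nu A = mu (f @^-1` A).
Proof. by exists map. Qed.

End FinitePushforward.

(** * Conformal measure of a family of homeomorphisms restricted to intervals *)

Section ConformalMeasure.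
Variables (R : realType) (n : nat) (c d : 'I_n -> R) (h k : 'I_n -> R -> R).
Hypothesis cd : forall i, c i < d i.
Hypothesis hk : forall i, monotone_bijection (h i) (k i).

Let alive_count := word_count (alive c d h).
Variable s : R.
Hypothesis sE : growth_rate R alive_count = s.
Let bd e := word_count (bd_word c d h e).

Hypothesis s_gt0 : 0 < s.
Hypothesis bd_lt : forall i,
  growth_rate R (bd (c i)) < s /\ growth_rate R (bd (d i)) < s.

Lemma bd_total_geometric : exists r C : R, [/\ 0 < r, r < s, 0 <= C &
  forall m, (bd_total c d h m)%:R <= C * r ^+ m].
Proof.
pose s0 := \big[Num.max/0]_(i < n)
  Num.max (growth_rate R (bd (c i))) (growth_rate R (bd (d i))).
have s00 : 0 <= s0 by exact: bigmax_ge_id.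
have s0s : s0 < s.
  apply: (big_ind (fun x => x < s)) => // [x y xs ys|i _]; rewrite gt_max.
    by rewrite xs ys.
  by apply/andP; exact: bd_lt.
(* The midpoint leaves room on both sides: all boundary rates lie below [r], and [r] lies below
   [s]. *)
pose r := (s0 + s) / 2.
have s0r : s0 < r by rewrite midf_lt.
have rs : r < s by rewrite midf_lt.
have r0 : 0 < r := le_lt_trans s00 s0r.
have ex i : exists M, forall m, (M <= m)%N ->
    (bd (c i) m + bd (d i) m)%:R <= 2 * r ^+ m.
  have le_s0 : Num.max (growth_rate R (bd (c i))) (growth_rate R (bd (d i))) <= s0.
    exact: le_bigmax.
  have := le_lt_trans le_s0 s0r; rewrite gt_max => /andP[cr dr].
  have [M1 H1] := growth_rate_lt (word_count_le _) cr.
  have [M2 H2] := growth_rate_lt (word_count_le _) dr.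
  exists (maxn M1 M2) => m; rewrite geq_max => /andP[/H1 m1 /H2 m2].
  by rewrite natrD mulr_natl mulr2n lerD.
have [M MP] := choice ex.
have [||C C0 CP] := @geometric_bound R (bd_total c d h) (n%:R * 2) r (\max_i M i) r0.
- by rewrite mulr_ge0.
- move=> m mM; rewrite /bd_total natr_sum -mulrA -[n in n%:R]card_ord mulr_natl.
  rewrite -sumr_const; apply: ler_sum => i _; apply: MP.
  by apply: leq_trans mM; exact: leq_bigmax.
by exists r, C.
Qed.

Let lam_spec (lam : set R -> R) := content1 lam /\
  forall A, lam A = s^-1 * \sum_(i < n) lam (open_image c d h i A).

Lemma conformal_content : exists lam, lam_spec lam.
Proof.
have [r [C [r0 rs C0 uC]]] := bd_total_geometric.
have cat m l : (alive_count (m + l) <= alive_count m * alive_count l)%N.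
  by apply: word_count_cat => g1 g2; exact: alive_cat.
have a0 : alive_count 0 = 1%N.
  by rewrite /alive_count word_count_nil; case: asboolP => // -[]; exists 0.
have s_gt0' : 0 < growth_rate R alive_count by rewrite sE.
apply: (@limit_content R R n (open_image c d h) (point_count c d h k)
  (bd_total c d h) s (C / (1 - r / s))) => //.
- exact: point_countU.
- by rewrite point_countT.
- exact: point_countS_ge.
- exact: point_countS_le.
- exact: sum_div_geometric.
(* Fekete's bound: the number of alive words is at least [s ^ m]. *)
- move=> m; rewrite point_countT ler_pdivlMr ?exprn_gt0// mul1r.
  by rewrite -sE; apply: (submultiplicative_ge (word_count_le _)) => //; rewrite sE.
- move=> e e0 M.
  have [N MN H] := sum_dominates_next (word_count_le _) a0 s_gt0' e0 M; rewrite sE in H.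
  exists N => //; rewrite point_countT; apply: le_trans H _.
  rewrite ler_pM2l//; apply: ler_sum => m _.
  by rewrite point_countT.
Qed.

(** On a suitable neighbourhood the content is at most the number of alive words of length [m] whose
    closed domain contains [h i e], divided by [s ^ m]; the boundary rates make this small for some
    [m]. *)
Lemma conformal_content_small lam : lam_spec lam ->
  forall i e, e = c i \/ e = d i -> forall eps : R, 0 < eps ->
  exists V : set R, [/\ open V, V (h i e) & lam V <= eps].
Proof.
move=> [lamc lamE] i e ie eps eps0.
have [r [C [r0 rs C0 uC]]] := bd_total_geometric.
have [m mP] := convolution_small r0 rs C0 uC eps0.
have [V [oV Vp VP]] := near_word_count c d hk (h i e) m.
exists V; split => //; apply: le_trans mP.
apply: le_trans (content_le_word_count s_gt0 lamc lamE m V) _.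
rewrite ler_pM2r ?invr_gt0 ?exprn_gt0// ler_nat; apply: leq_trans VP _.
exact: word_count_cdom.
Qed.

(** One use of the identity suffices: a set missing every []c i, d i[] has empty open images, and
    [[- B, B]] contains all these intervals. *)
Lemma conformal_content_support lam : lam_spec lam ->
  exists lo hi : R, forall A, A `&` `[lo, hi] = set0 -> lam A = 0.
Proof.
move=> [lamc lamE]; pose B := \sum_(i < n) (`|c i| + `|d i|).
exists (- B), B => A A0; rewrite lamE big1 ?mulr0// => i _.
rewrite (_ : open_image _ _ _ _ _ = set0) ?content1_set0//.
apply/seteqP; split => // y [x [Ax xI] _].
suff : (A `&` `[- B, B]) x by rewrite A0.
split => //; move: xI; rewrite /= !in_itv/= => /andP[cx xd].
have : `|c i| + `|d i| <= B.
  by rewrite /B (bigD1 i)//= lerDl; apply: sumr_ge0 => j _; rewrite addr_ge0.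
have := normr_ge0 (c i); have := normr_ge0 (d i).
have := ler_norm (d i); have := ler_norm (- c i); rewrite normrN.
by move=> *; apply/andP; split; lra.
Qed.

(** Closed intervals, as in [simage]; the content obeys its identity with open ones, and
    [conformal_segment] reconciles the two. *)
Let image i (J : set R) : set R := h i @` (J `&` `[c i, d i]).

Let mk i : measurable_fun [set: measurableTypeR R] (k i : _ -> measurableTypeR R).
Proof.
apply: continuous_measurable_fun.
exact: monotone_bijection_continuous (monotone_bijection_inv (hk i)).
Qed.

(** An image under [h i] is a preimage under its continuous inverse. *)
Lemma measurable_image i (J : set (measurableTypeR R)) :
  measurable J -> measurable (image i J : set (measurableTypeR R)).
Proof.
move=> mJ; rewrite (_ : image i J = setT `&` k i @^-1` (J `&` `[c i, d i])).
  by apply: mk => //; apply: measurableI => //; exact: measurable_itv.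
have [hK kK _] := hk i.
apply/seteqP; split => [_ [x xJ <-]|y [_ yJ]]; last by exists (k i y).
by split => //; rewrite /preimage/= hK.
Qed.

Lemma image_segment i a b : exists a' b', image i `[a, b] = `[a', b']%classic.
Proof.
pose a1 := Num.max a (c i); pose b1 := Num.min b (d i).
have E : `[a, b] `&` `[c i, d i] = `[a1, b1]%classic.
  apply/seteqP; split => x /=; rewrite !in_itv/= /a1 /b1 ge_max le_min.
    by move=> [/andP[-> ->] /andP[-> ->]].
  by move=> /andP[/andP[-> ->] /andP[-> ->]].
rewrite /image E; have [hK kK [hm|hm]] := hk i.
- exists (h i a1), (h i b1); apply/seteqP; split => y /=.
    by move=> [x + <-]; rewrite !in_itv/= !hm.
  by rewrite in_itv/= => yI; exists (k i y) => //=; rewrite in_itv/= -(hm a1) -(hm _ b1) kK.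
- exists (h i b1), (h i a1); apply/seteqP; split => y /=.
    by move=> [x + <-]; rewrite !in_itv/= !hm andbC.
  by rewrite in_itv/= => yI; exists (k i y) => //=; rewrite in_itv/= -(hm _ a1) -(hm b1) kK andbC.
Qed.

(** Each inequality transports open neighbourhoods of segments through the maps, first backwards,
    then forwards; it is the forward direction that uses the small content near the images of the
    endpoints. *)
Lemma conformal_segment (lam : set R -> R) (P : probability (measurableTypeR R) R) :
  lam_spec lam ->
  (forall a b : R,
    (forall V : set R, open V -> `[a, b] `<=` V -> (P `[a, b]%classic <= (lam V)%:E)%E) /\
    (forall e, 0 < e -> exists V : set R, [/\ open V, `[a, b] `<=` V &
       ((lam V)%:E <= P `[a, b]%classic + e%:E)%E])) ->
  forall a b, P `[a, b]%classic =
    ((s^-1)%:E * \sum_(i < n) P (image i `[a, b]))%E.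
Proof.
move=> lamP PP a b; have [lamc lamE] := lamP.
have [lam0 _ _] := lamc.
have mab (x y : R) : measurable (`[x, y]%classic : set (measurableTypeR R)).
  exact: measurable_itv.
have mim i := measurable_image i (mab a b).
have Pfin A : measurable A -> P A \is a fin_num by move=> ?; exact: fin_num_measure.
pose p i := fine (P (image i `[a, b])).
have -> : (\sum_(i < n) P (image i `[a, b]))%E = (\sum_(i < n) p i)%:E.
  rewrite -sumEFin; apply: eq_bigr => i _; rewrite /p fineK//; exact: Pfin.
rewrite -EFinM -(fineK (Pfin _ (mab a b))); congr EFin.
set q := fine _.
have pV i V : open V -> image i `[a, b] `<=` V -> p i <= lam V.
  move=> oV; have [a' [b' E]] := image_segment i a b.
  rewrite /p E => iV; have [/(_ V oV iV) + _] := PP a' b'.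
  by rewrite -{1}(fineK (Pfin _ (mab a' b'))) lee_fin.
have pe i e : 0 < e -> exists V : set R, [/\ open V, image i `[a, b] `<=` V &
    lam V <= p i + e].
  move=> e0; have [a' [b' E]] := image_segment i a b.
  have [_ /(_ e e0)[V [oV Vi Ve]]] := PP a' b'.
  exists V; rewrite E; split => //; move: Ve.
  by rewrite /p E -{1}(fineK (Pfin _ (mab a' b'))) -EFinD lee_fin.
apply/eqP; rewrite eq_le; apply/andP; split.
  apply/ler_addgt0Pr => e e0.
  (* The [n] errors, scaled by [s^-1], total [e * n / (n + 1)]. *)
  pose e1 := s * (e / (n%:R + 1)).
  have n1 : 0 < n%:R + 1 :> R by rewrite ltr_wpDl.
  have e10 : 0 < e1 by rewrite mulr_gt0// divr_gt0.
  have [W WP] := choice (fun i => pe i e1 e10).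
  (* Points outside the closed interval do not affect the open image, so [V i] can contain all of
     [[a, b]] while its open image stays in [W i]. *)
  pose V i := h i @^-1` W i `|` ~` `[c i, d i].
  have oV i : open (V i).
    have [oW _ _] := WP i.
    apply: openU.
      apply: open_comp => // x _; exact: (monotone_bijection_continuous (hk i)).
    exact/closed_openC/interval_closed.
  have KV i : `[a, b] `<=` V i.
    move=> x xab; have [xI|] := pselect (`[c i, d i]%classic x); last by right.
    by left; have [_ Wi _] := WP i; apply: Wi; exists x.
  pose V0 : set R := interior [set x | forall i, V i x].
  have KV0 : `[a, b] `<=` V0.
    move=> x xab; apply: (filter_forall (nbhs_filter x)) => i.
    by apply: open_nbhs_nbhs; split => //; exact: KV.
  have [/(_ V0 (open_interior _) KV0) + _] := PP a b.
  rewrite -(fineK (Pfin _ (mab a b))) lee_fin -/q => /le_trans; apply.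
  rewrite lamE.
  apply: (@le_trans _ _ (s^-1 * \sum_(i < n) (p i + e1))).
    rewrite ler_pM2l ?invr_gt0//; apply: ler_sum => i _.
    have [_ _ We] := WP i; apply: le_trans We.
    apply: le_content1 => // _ [x [/interior_subset xV xI] <-].
    by have [//|] := xV i; case; exact: subset_itv_oo_cc xI.
  rewrite big_split/= mulrDr lerD2l sumr_const card_ord -mulr_natl /e1.
  rewrite mulrCA mulKf ?gt_eqF// mulrCA ger_pMr//.
  by rewrite ler_pdivrMr// mul1r lerDl.
apply/ler_addgt0Pr => e e0.
(* The [n] errors of size [2 * e1], scaled by [s^-1], then total less than [e / 2]. *)
pose e1 := s * (e / (2 * (2 * n%:R + 1))).
have n1 : 0 < 2 * (2 * n%:R + 1) :> R by rewrite mulr_gt0// ltr_wpDl// mulr_ge0.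
have e10 : 0 < e1 by rewrite mulr_gt0// divr_gt0.
have e2 : 0 < e / 2 by rewrite divr_gt0.
have [V [oV KV Ve]] : exists V : set R, [/\ open V, `[a, b] `<=` V & lam V <= q + e / 2].
  have [_ /(_ _ e2)[V [oV KV Ve]]] := PP a b; exists V; split => //.
  by move: Ve; rewrite -(fineK (Pfin _ (mab a b))) -EFinD lee_fin.
(* Of the image of [[a, b]], the open image of [V] can miss only the images of the two endpoints;
   neighbourhoods of small content cover these. *)
have pi i : p i <= lam (open_image c d h i V) + 2 * e1.
  have [N1 [oN1 N1p N1e]] := conformal_content_small lamP (or_introl (erefl (c i))) e10.
  have [N2 [oN2 N2p N2e]] := conformal_content_small lamP (or_intror (erefl (d i))) e10.
  apply: (@le_trans _ _ (lam (open_image c d h i V `|` (N1 `|` N2)))).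
    apply: pV.
      apply: openU; last exact: openU.
      apply: (monotone_bijection_openX (hk i)); apply: openI => //.
    move=> _ [x [xab xI] <-].
    have [->|xc] := eqVneq x (c i); first by right; left.
    have [->|xd] := eqVneq x (d i); first by right; right.
    left; exists x => //; split; first exact: KV.
    move: xI; rewrite /= !in_itv/= => /andP[cx dx].
    by rewrite lt_neqAle eq_sym xc cx lt_neqAle xd.
  apply: le_trans (content1_leU _ _ lamc) _; rewrite lerD2l.
  by apply: le_trans (content1_leU _ _ lamc) _; lra.
apply: (@le_trans _ _ (lam V + e / 2)); last by lra.
rewrite lamE.
apply: (@le_trans _ _ (s^-1 * \sum_(i < n) (lam (open_image c d h i V) + 2 * e1))).
  by rewrite ler_pM2l ?invr_gt0//; apply: ler_sum => i _; exact: pi.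
rewrite big_split/= mulrDr lerD2l sumr_const card_ord -[X in s^-1 * X]mulr_natl /e1.
have -> : s^-1 * (n%:R * (2 * (s * (e / (2 * (2 * n%:R + 1)))))) =
    (s^-1 * s) * (e / 2 * ((2 * n%:R) / (2 * n%:R + 1))).
  by rewrite invfM; ring.
rewrite mulVf ?gt_eqF// mul1r ger_pMr// ler_pdivrMr ?ltr_wpDl ?mulr_ge0//.
by rewrite mul1r lerDl.
Qed.

(** Restricting [P] to the image of the whole line and pushing it forward under [k i] gives
    [P (image i J)]. This provides the second measure for the uniqueness argument. *)
Lemma image_measure (P : probability (measurableTypeR R) R) :
  exists mu : {measure set (measurableTypeR R) -> \bar R},
  forall J, mu J = ((s^-1)%:E * \sum_(i < n) P (image i J))%E.
Proof.
have mD i : measurable (image i setT : set (measurableTypeR R)).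
  exact: measurable_image.
have [nu nuE] := choice (fun i => finite_pushforward (@mk i) (mrestr P (mD i))).
(* [msum] is indexed by naturals; the default [mzero] does not occur below [n]. *)
pose m_ (j : nat) : {measure set (measurableTypeR R) -> \bar R} :=
  if insub j is Some i then nu i else mzero.
have s1 : 0 <= s^-1 by rewrite invr_ge0 ltW.
exists (mscale (NngNum s1) (msum m_ n)) => J.
rewrite /mscale /msum/=; congr (_ * _)%E; apply: eq_bigr => i _.
have -> : m_ i J = nu i J by rewrite /m_ valK.
rewrite nuE /mrestr; congr (P _).
have [hK kK _] := hk i.
apply/seteqP; split => [y [Jy [x [_ xI] xy]]|_ [x [Jx xI] <-]].
  by exists x => //; split => //; move: Jy; rewrite /preimage/= -xy hK.
by split; [rewrite /preimage/= hK|exists x].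
Qed.

(** Both sides are measures in [J] that agree on segments, and segments are stable under
    intersection, generate the Borel sets and exhaust the line with finite measure. *)
Lemma conformal_measure : exists P : probability (measurableTypeR R) R,
  forall J, measurable J ->
    P J = ((s^-1)%:E * \sum_(i < n) P (image i J))%E.
Proof.
have [lam lamP] := conformal_content.
have [lo [hi supp]] := conformal_content_support lamP.
have [lamc _] := lamP.
have [P PP] := content_regularization lamc supp.
have Pseg := conformal_segment lamP PP.
exists P => J mJ; have [mu muE] := image_measure P.
rewrite -muE.
pose G : set (set (measurableTypeR R)) :=
  [set `[x.1, x.2]%classic | x in [set: R * R]].
pose g (j : nat) : set (measurableTypeR R) := `[- j%:R, j%:R]%classic.
have GJ : <<s G >> J.
  move: J mJ; apply: smallest_sub; first exact: smallest_sigma_algebra.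
  move=> _ [[a b] _ <-] /=.
  (* Singletons are segments too, which yields the half-open generators. *)
  have -> : `]a, b]%classic = `[a, b]%classic `\` `[a, a]%classic :> set R.
    apply/seteqP; split => x /=; rewrite !in_itv/=.
      move=> /andP[ax ->]; rewrite (ltW ax); split => // /andP[_].
      by rewrite leNgt ax.
    move=> [/andP[ax ->]]; rewrite ax/= => /negP; rewrite -ltNge => ->.
    by [].
  have sG (x y : R) : <<s G >> (`[x, y]%classic : set R).
    by apply: sub_sigma_algebra; exists (x, y).
  exact: (@measurableD _ (g_sigma_algebraType G) _ _ (sG a b) (sG a a)).
apply: (@g_sigma_algebra_measure_unique _ _ _ G _ g) => //.
- by move=> _ [[a b] _ <-]; exact: measurable_itv.
- by move=> j; exists (- j%:R, j%:R).
- apply/seteqP; split => // x _; exists (Num.truncn `|x|).+1 => //=.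
  by rewrite /g/= in_itv/= -ler_norml ltW// truncnS_gt.
- move=> _ _ [[a b] _ <-] [[a' b'] _ <-] /=; exists (Num.max a a', Num.min b b') => //=.
  apply/seteqP; split => x /=; rewrite !in_itv/= ge_max le_min.
    by move=> /andP[/andP[-> ->] /andP[-> ->]].
  by move=> [/andP[-> ->] /andP[-> ->]].
- by move=> _ [[a b] _ <-] /=; rewrite muE; exact: Pseg.
- move=> j; rewrite (le_lt_trans (probability_le1 _ _)) ?ltry//.
  exact: measurable_itv.
Qed.

End ConformalMeasure.

(** * Words of a system expressed through the extended maps *)

Section SystemWords.
Variables (R : realType) (n : nat) (F : system R n) (h k : 'I_n -> R -> R).
Hypothesis hk : forall i, monotone_bijection (h i) (k i).
Hypothesis hF : forall i, {in `[cl F i, cr F i], smap F i =1 h i}.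

Lemma word_dom_cdom g : word_dom F g = cdom (cl F) (cr F) h g.
Proof.
elim: g => [|i g IH] /=; first by apply/seteqP; split.
(* An undefined composition stays undefined. *)
have none : foldl (fun y j => obind (spartial F j) y) None g = None.
  by elim: (g).
rewrite -IH; apply/seteqP; split => x; rewrite /word_dom /word_map /= /spartial.
  case: ifPn => xI; last by rewrite none.
  by move=> gx; split => //; rewrite /preimage/= -hF.
by move=> [xI]; rewrite /preimage/= -hF// xI.
Qed.

Lemma lap_countE m : lap_count F m = word_count (alive (cl F) (cr F) h) m.
Proof.
rewrite /lap_count; apply: eq_card => t; rewrite !finset.inE.
by rewrite word_dom_cdom (interior_cdom _ _ hk).
Qed.

Lemma bd_lap_countE e m :
  bd_lap_count F e m = word_count (bd_word (cl F) (cr F) h e) m.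
Proof.
rewrite /bd_lap_count; apply: eq_card => t; rewrite !finset.inE.
congr (`[< _ >]); rewrite word_dom_cdom /boundary (interior_cdom _ _ hk).
rewrite -((closure_id _).1 (@closed_cdom _ _ (cl F) (cr F) _ _ hk t)).
by apply/propext; split => [[a [b ?]]|[a b ?]].
Qed.

Lemma simageE i J :
  simage F i J = h i @` (J `&` `[cl F i, cr F i]).
Proof.
by apply: eq_imagel => x [_ xI]; exact: hF.
Qed.

End SystemWords.

(** The clause [Lambda setT <> 0%E] excludes the zero measure, for which the identity is trivial;
    stability of [B] under [simage] ensures that the right-hand side measures only members of
    [B]. *)
Theorem theorem1p2 (R : realType) (n : nat) (hn : (0 < n)%N) (F : system R n)
    (hs : bd_lap_growth F < lap_growth F) :
  exists2 B : set (set R), sigma_algebra setT B &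
  exists Lambda : {finite_measure set (g_sigma_algebraType B) -> \bar R},
    Lambda setT <> 0%E /\
    forall J : set R, B J ->
      (forall i : 'I_n, B (simage F i J)) /\
      Lambda J = (((lap_growth F)^-1)%:E * \sum_(i < n) Lambda (simage F i J))%E.
Proof.
have ext i : exists hk : (R -> R) * (R -> R), monotone_bijection hk.1 hk.2 /\
    {in `[cl F i, cr F i], smap F i =1 hk.1}.
  have [h [k hkP]] := strictly_monotone_extension (@cl_lt_cr _ _ F i)
    (@smap_continuous _ _ F i) (@smap_monotone _ _ F i).
  by exists (h, k).
have [hk_ hkP] := choice ext.
pose h i := (hk_ i).1; pose k i := (hk_ i).2.
have hk i : monotone_bijection (h i) (k i) by have [] := hkP i.
have hF i : {in `[cl F i, cr F i], smap F i =1 h i} by have [] := hkP i.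
have sE : growth_rate R (word_count (alive (cl F) (cr F) h)) = lap_growth F.
  by rewrite /lap_growth; congr growth_rate; apply/funext => m; rewrite (lap_countE hk hF).
(* The maximum in [bd_lap_growth] starts from 0, so [hs] gives positivity. *)
have s_gt0 : 0 < lap_growth F.
  by apply: le_lt_trans hs; exact: bigmax_ge_id.
have bdE e : growth_rate R (word_count (bd_word (cl F) (cr F) h e)) =
    growth_rate R (bd_lap_count F e).
  by congr growth_rate; apply/funext => m; rewrite (bd_lap_countE hk hF).
have bd_lt i : growth_rate R (word_count (bd_word (cl F) (cr F) h (cl F i)))
      < lap_growth F /\
    growth_rate R (word_count (bd_word (cl F) (cr F) h (cr F i))) < lap_growth F.
  rewrite !bdE; apply/andP; rewrite -gt_max; apply: le_lt_trans hs.
  exact: (le_bigmax _ (fun i => Num.max _ _)).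
have [P PE] := conformal_measure (@cl_lt_cr _ _ F) hk sE s_gt0 bd_lt.
pose B : set (set R) := @measurable _ (measurableTypeR R).
have sB : sigma_algebra setT B by exact: sigma_algebra_measurable.
exists B; first exact: sB.
(* [B] is already a sigma-algebra, so it equals the one it generates, and the identity carries [P]
   over. *)
have mid : measurable_fun [set: measurableTypeR R]
    (id : measurableTypeR R -> g_sigma_algebraType B).
  move=> _ A mA; rewrite setTI preimage_id.
  have sA : <<s B >> A := mA.
  by rewrite (sigma_algebra_id sB) in sA.
have [L LE] := finite_pushforward mid P.
have LP (A : set R) : L A = P A := LE A.
exists L; split.
  by rewrite LP probability_setT; apply/eqP; rewrite onee_neq0.
move=> J BJ; split => [i|].
  by rewrite (simageE hF); exact: (measurable_image (cl F) (cr F) hk).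
rewrite LP (PE _ BJ); congr (_ * _)%E; apply: eq_bigr => i _.
by rewrite LP (simageE hF).
Qed.
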